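(* Let $n\ge2$ and let the cost functional be $C(F)=\Upsilon\left(\int_0^1\gamma(x)\,dF(x)\right)$ for all $F\in\mathcal F$, where $\gamma:[0,1]\to\mathbb R_+$ and $\Upsilon:[0,\gamma(1)]\to\mathbb R$ satisfy: (1) $\gamma$ is continuous, strictly increasing, concave, and $\gamma(0)=0$; (2) $\Upsilon$ is increasing, convex, and continuously differentiable; (3) $z\mapsto z\Upsilon'(z)$ is strictly increasing on $[0,\gamma(1)]$; (4) $\Upsilon'(0)\gamma(1)>1$. Let $\mathbf v=(v_1,\dots,v_n)$ and $\mathbf w=(w_1,\dots,w_n)$ be two prize vectors such that $\mathbf w$ majorizes $\mathbf v$, and $v_1>v_2$ and $w_1>w_2$. Let $F$ and $G$ be the symmetric equilibrium cdfs of the rank-order contests with prizes $\mathbf v$ and $\mathbf w$ respectively, and let $X\sim F$ and $Y\sim G$. Then $Y$ dominates $X$ in the increasing convex order, i.e. $\mathbb E[u(Y)]\ge\mathbb E[u(X)]$ for every increasing convex function $u$.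
   Context: $\mathcal F$ is the set of cdfs on $[0,1]$ (right-continuous nondecreasing $F:[0,1]\to[0,1]$ with $F(1)=1$); $dF$ is the induced probability measure, with $dF([0,x])=F(x)$. A prize vector is $\mathbf v=(v_1,\dots,v_n)$ with $v_1\ge\cdots\ge v_n=0$ and $\sum_{k=1}^n v_k=1$. $\mathbf w$ majorizes $\mathbf v$ if $\sum_{k=1}^m w_k\ge\sum_{k=1}^m v_k$ for all $m=1,\dots,n$, with equality at $m=n$. Rank-order contest with prizes $\mathbf v$: each of $n$ players chooses $F_i\in\mathcal F$; performances $X_i\sim dF_i$ are drawn independently; players are ranked by performance from highest to lowest with ties broken uniformly at random, and the player ranked $k$-th receives $v_k$. Player $i$'s gross payoff $\pi_i(x_1,\dots,x_n)$ is the expected prize given performances $x$ (averaging over tie-breaking), and the net payoff is $u_i(F_1,\dots,F_n)=\mathbb E[\pi_i(X_1,\dots,X_n)]-C(F_i)$. $F\in\mathcal F$ is a symmetric equilibrium if $u_1(F,F,\dots,F)\ge u_1(H,F,\dots,F)$ for all $H\in\mathcal F$. (Under the stated hypotheses the symmetric equilibrium for each of the two prize vectors is unique.) *)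

(* Defs.v *)
From HB Require Import structures.
From mathcomp Require Import all_boot all_order all_algebra perm.
From mathcomp Require Import all_classical all_reals all_analysis.

Set Implicit Arguments.
Unset Strict Implicit.
Unset Printing Implicit Defensive.

Import Order.TTheory GRing.Theory Num.Theory.
Import numFieldNormedType.Exports.

Local Open Scope classical_set_scope.
Local Open Scope ring_scope.

(* A cdf on [0,1] is identified with its extension to the real line by 0 on
   ]-oo, 0[ and by 1 on ]1, +oo[; F 0 may be positive (an atom at 0). *)
Record cdf01 (R : realType) := Cdf01 {
  cdf01_fun :> cumulativeBounded (0 : R) (1 : R) ;
  cdf01_lt0 : forall x : R, x < 0 -> cdf01_fun x = 0 ;
  cdf01_1 : cdf01_fun 1 = 1 }.

Definition dcdf (R : realType) (F : cdf01 R) :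
    probability (measurableTypeR R) R :=
  lebesgue_stieltjes_measure (cdf01_fun F).

Lemma dcdf_itv (R : realType) (F : cdf01 R) (x : R) :
  0 <= x -> dcdf F `[0, x]%classic = (F x)%:E.
Proof.
move=> x0.
have oc (a : R) : a <= x -> dcdf F `]a, x]%classic = (F x - F a)%:E.
  move=> ax; rewrite /dcdf/= /lebesgue_stieltjes_measure /measure_extension/=.
  by rewrite measurable_mu_extE/= ?wlength_itv_bnd//; exact: is_ocitv.
have -> : `[0, x]%classic = \bigcap_n `](- n.+1%:R^-1 : R), x]%classic.
  apply/seteqP; split => [y/= + n _ /=|y /= H].
    rewrite !in_itv/= => /andP[y0 ->]; rewrite andbT.
    by rewrite (lt_le_trans _ y0)// oppr_lt0 invr_gt0 ltr0n.
  have yx : y <= x by have := H 0%N I; rewrite /= in_itv/= => /andP[].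
  rewrite in_itv/= yx andbT leNgt; apply/negP => y0.
  have := H (Num.truncn (- y)^-1) I; rewrite /= in_itv/= => /andP[+ _].
  rewrite ltrNl => /ltW; rewrite leNgt => /negP; apply.
  rewrite invf_plt ?posrE ?oppr_gt0 ?ltr0n//.
  exact: Num.Theory.truncnS_gt.
have := @nonincreasing_cvg_mu _ _ _ (dcdf F)
  (fun n => `](- n.+1%:R^-1 : R), x]%classic).
have nle (n : nat) : - n.+1%:R^-1 <= x :> R.
  by rewrite (le_trans _ x0)// oppr_le0 invr_ge0.
move=> /(_ _ _ _ _) => cv.
have {}cv : dcdf F `](- n.+1%:R^-1 : R), x]%classic @[n --> \oo] -->
    dcdf F (\bigcap_n `](- n.+1%:R^-1 : R), x]%classic).
  apply: cv => //.
  - by have := oc _ (nle 0%N); rewrite /= => ->; rewrite ltry.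
  - by apply: bigcap_measurable.
  - move=> m n mn; apply/subsetPset/subset_itvr.
    by rewrite bnd_simp lerN2 lef_pV2 ?posrE ?ltr0n// ler_nat.
suff : dcdf F `](- n.+1%:R^-1 : R), x]%classic @[n --> \oo] --> (F x)%:E.
  by apply: cvg_unique cv.
under eq_fun do rewrite oc//.
apply: cvg_near_cst; near=> n.
rewrite [F (- _)]cdf01_lt0 ?subr0//.
Unshelve. all: by end_near. Qed.

Section independent_draws.
Variable R : realType.
Local Notation mR := (measurableTypeR R).

Definition cons_draw (n : nat) (p : mR * n.-tuple mR) : n.+1.-tuple mR :=
  [tuple of p.1 :: p.2].

Lemma measurable_cons_draw (n : nat) : measurable_fun setT (@cons_draw n).
Proof. exact: measurable_cons measurable_fst measurable_snd. Qed.

HB.instance Definition _ (n : nat) :=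
  @isMeasurableFun.Build _ _ _ _ (@cons_draw n) (@measurable_cons_draw n).

(* The product measure P_0 \x ... \x P_(n-1) on n-tuples, i.e. the joint law of
   n independent draws. *)
Fixpoint joint_law (n : nat) :
    ('I_n -> probability mR R) -> probability (n.-tuple mR) R :=
  match n with
  | 0 => fun=> dirac ([tuple] : 0.-tuple mR)
  | n'.+1 => fun P =>
      distribution (P ord0 \x joint_law (fun i => P (lift ord0 i)))%E
        (@cons_draw n')
  end.

Lemma joint_law_box (n : nat) (P : 'I_n -> probability mR R)
    (A : 'I_n -> set mR) : (forall i, measurable (A i)) ->
  joint_law P [set x | forall i, A i (tnth x i)] = (\prod_(i < n) P i (A i))%E.
Proof.
elim: n P A => [|n IH] P A mA.
  by rewrite big_ord0 /= diracE mem_set//= => -[].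
rewrite big_ord_recl -IH//=.
rewrite /distribution /pushforward.
rewrite -product_measure1E//; last first.
  rewrite [X in measurable X](_ : _ =
      \bigcap_(i in [set: 'I_n]) ((@tnth n mR)^~ i @^-1` A (lift ord0 i))); last first.
    by apply/seteqP; split => [x H i _|x H i]; [exact: H|exact: H].
  apply: fin_bigcap_measurable => [|i _]; first exact: finite_finset.
  by rewrite -[X in measurable X]setTI; apply: measurable_tnth.
congr product_measure1; apply/seteqP; split => [[a x]/= H|[a x]/= [H0 H] i].
  split; first by have := H ord0.
  by move=> i; have := H (lift ord0 i); rewrite tnthS.
by case: (unliftP ord0 i) => [j|] ->; rewrite ?tnthS//.
Qed.

End independent_draws.

Section contest.
Variables (R : realType) (n : nat).
Local Notation mR := (measurableTypeR R).

(* Prizes are numbered from 0: v`_k is the prize for being ranked (k+1)-th. *)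
Definition prize_vector (v : n.-tuple R) : Prop :=
  [/\ sorted >=%R v, v`_n.-1 = 0 & \sum_(k < n) v`_k = 1].

Definition majorizes (w v : n.-tuple R) : Prop :=
  (forall m, (1 <= m <= n)%N -> \sum_(k < m) v`_k <= \sum_(k < m) w`_k) /\
  \sum_(k < n) w`_k = \sum_(k < n) v`_k.

(* s i is the (0-based) rank of player i; the rankings compatible with the
   performances x are those that differ only by the way ties are broken. *)
Definition compatible_ranking (x : n.-tuple mR) (s : 'S_n) : bool :=
  [forall i, forall j, (tnth x j < tnth x i) ==> (s i < s j)%N].

Definition gross_payoff (v : n.-tuple R) (i : 'I_n) (x : n.-tuple mR) : R :=
  (\sum_(s : 'S_n | compatible_ranking x s) v`_(s i)) /
  #|compatible_ranking x|%:R.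

Definition net_payoff (v : n.-tuple R) (C : cdf01 R -> R) (i : 'I_n)
    (F : 'I_n -> cdf01 R) : R :=
  (\int[joint_law (fun j => dcdf (F j))]_x gross_payoff v i x) - C (F i).

Definition symmetric_equilibrium (v : n.-tuple R) (C : cdf01 R -> R)
    (F : cdf01 R) : Prop :=
  forall (i : 'I_n), i = 0%N :> nat -> forall H : cdf01 R,
    net_payoff v C i (fun j => if j == i then H else F) <=
    net_payoff v C i (fun=> F).

End contest.

Section real_functions.
Variable R : realType.

(* Derivatives relative to a set A: one-sided at the endpoints of an interval. *)
Definition diff_quotient (f : R -> R) (x y : R) : R := (f y - f x) / (y - x).

Definition derivable_in (A : set R) (f : R -> R) (x : R) : Prop :=
  cvg (diff_quotient f x @ within A x^').

Definition derive_in (A : set R) (f : R -> R) (x : R) : R :=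
  lim (diff_quotient f x @ within A x^').

Definition continuously_derivable_in (A : set R) (f : R -> R) : Prop :=
  (forall x, A x -> derivable_in A f x) /\ {within A, continuous (derive_in A f)}.

End real_functions.

(* E[u(X)] <= E[u(Y)] for X ~ dF, Y ~ dG and all u : [0,1] -> R nondecreasing
   and convex; u is allowed to jump at 1. *)
Definition icx_dominates (R : realType) (G F : cdf01 R) : Prop :=
  forall u : R -> R,
    {in `[0, 1] &, {homo u : x y / x <= y}} ->
    convex_function (`[0, 1]%classic : set R) u ->
  \int[dcdf F]_(x in `[0, 1]) u x <= \int[dcdf G]_(x in `[0, 1]) u x.

(* Main.v *)
(* Against opponents drawing independently from F, a performance x earns an
   expected prize e x between P_v(F(x-)) and P_v(F x), where P_v(q) is the
   mean of the prize when the number of better opponents is binomial with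
   parameter 1 - q. Comparing F with (1-t)F + t delta_x as t -> 0 gives e x
   <= c + lam gam x on [0,1] with equality dF-almost everywhere, lam being
   the marginal cost at F. An atom of F below 1 would be beaten by
   performances slightly above it, and an atom at 1 costs too much because
   lam gam 1 > 1; hence F is continuous, F(X) is uniform, and e = P_v o F.
   Low quantiles win almost nothing, so c = 0; and integrating P_v o F = lam
   gam yields z lam = 1/n for z = E[gam X]. As z |-> z Ups'(z) is strictly
   increasing, z and lam do not depend on the prizes.

   Therefore E[u(X)] = E[f(P_v(U))] with U uniform and f the composite of u
   with the inverse of lam gam, which is convex and nondecreasing. It
   remains to compare P_v(U) and P_w(U) in the convex order. A subgradient h
   of f gives the lower bound E[h(P_v U) (P_w - P_v)(U)], a combination of
   the numbers E[h(P_v U) b_j(U)], b_j the Bernstein polynomials, with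
   coefficients w - v. These numbers decrease with j, since b_j - b_(j+1)
   changes sign once and has mean 0; Abel summation and majorization
   conclude. *)

Require Import Defs.
From HB Require Import structures.
From mathcomp Require Import all_boot all_order all_algebra perm.
From mathcomp Require Import all_classical all_reals all_analysis.
From mathcomp Require Import measurable_realfun ring lra.

Set Implicit Arguments.
Unset Strict Implicit.
Unset Printing Implicit Defensive.

Import Order.TTheory GRing.Theory Num.Theory.
Import numFieldNormedType.Exports.

Local Open Scope classical_set_scope.
Local Open Scope ring_scope.

(** * Binomial means and convex functions *)

Section binomial_mean.
Variable R : realType.
Implicit Types (g h : nat -> R) (q : R) (m : nat).

(* g is evaluated at the number of successes, which have probability 1 - q *)
Fixpoint binomial_mean m g q : R :=
  if m is m'.+1 then
    q * binomial_mean m' g q + (1 - q) * binomial_mean m' (g \o succn) q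
  else g 0%N.

Lemma le_binomial_mean m g h q : 0 <= q <= 1 ->
  (forall k, (k <= m)%N -> g k <= h k) ->
  binomial_mean m g q <= binomial_mean m h q.
Proof.
move=> /andP[q0 q1]; elim: m g h => [|m IH] g h gh /=; first exact: gh.
rewrite lerD// ler_wpM2l ?subr_ge0//; apply: IH => k km; apply: gh => //.
exact: leqW.
Qed.

Lemma binomial_mean_cst m c q : binomial_mean m (fun=> c) q = c.
Proof.
elim: m => //= m; rewrite /comp => ->; ring.
Qed.

Lemma binomial_mean_ge0 m g q : 0 <= q <= 1 ->
  (forall k, (k <= m)%N -> 0 <= g k) -> 0 <= binomial_mean m g q.
Proof.
move=> q01 g0; rewrite -[leLHS](binomial_mean_cst m 0 q).
exact: le_binomial_mean.
Qed.

Lemma binomial_mean_1 m g : binomial_mean m g 1 = g 0%N.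
Proof. by elim: m g => //= m IH g; rewrite IH subrr mul0r mul1r addr0. Qed.

Lemma binomial_mean_0 m g : binomial_mean m g 0 = g m.
Proof. by elim: m g => //= m IH g; rewrite !IH mul0r subr0 mul1r add0r. Qed.

Lemma binomial_meanB m g h q :
  binomial_mean m (g \- h) q = binomial_mean m g q - binomial_mean m h q.
Proof.
elim: m g h => //= m IH g h; rewrite IH.
by rewrite [X in _ + _ * X](IH (g \o succn) (h \o succn)); ring.
Qed.

(** Induction on the first trial: raising q moves weight from the mean of [g \o succn] to the mean
    of [g], which is at least as large because [g] is nonincreasing. *)
Lemma binomial_mean_homo m g : {homo g : i j / (i <= j)%N >-> j <= i} ->
  {in `[0, 1] &, {homo binomial_mean m g : p q / p <= q}}.
Proof.
move=> + p q /[!in_itv]/= /andP[p0 p1] /andP[q0 q1] pq.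
elim: m g => [//|m IH] g ng /=.
have ngS : {homo g \o succn : i j / (i <= j)%N >-> j <= i}.
  by move=> i j ij; exact: ng.
have gp : binomial_mean m (g \o succn) p <= binomial_mean m g p.
  by apply: le_binomial_mean => [|k km]; rewrite ?p0//=; exact: ng.
have := IH _ ng; have := IH _ ngS.
nra.
Qed.

(** The Bernstein polynomial of index j in the variable 1 - q, i.e. the probability of j successes
    in m trials. For j > m the binomial coefficient vanishes, so truncation in m - j does no
    harm. *)
Definition bernstein m j q : R := 'C(m, j)%:R * q ^+ (m - j) * (1 - q) ^+ j.

(** Pascal's rule, or conditioning on the first trial. *)
Lemma bernsteinSS m j q :
  bernstein m.+1 j.+1 q = q * bernstein m j.+1 q + (1 - q) * bernstein m j q.
Proof.
rewrite /bernstein binS natrD subSS.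
have [jm|mj] := ltnP j m.
  by rewrite -(subnSK jm) !exprS; ring.
by rewrite (bin_small (n := m) (m := j.+1))//; rewrite !exprS; ring.
Qed.

Lemma binomial_meanE m g q :
  binomial_mean m g q = \sum_(j < m.+1) g j * bernstein m j q.
Proof.
elim: m g => [|m IH] g.
  by rewrite big_ord1 /bernstein bin0 !expr0 !mulr1.
rewrite /= !IH big_ord_recl [RHS]big_ord_recl.
under [X in _ = _ + X]eq_bigr do rewrite lift0 bernsteinSS mulrDr.
rewrite big_split/= [in LHS]mulrDr [RHS]addrA; congr (_ + _ + _).
- by rewrite /bernstein !bin0 !subn0 exprS; ring.
- rewrite [RHS]big_ord_recr/= [X in _ * (_ * X)]/bernstein bin_small//.
  rewrite !mul0r !mulr0 addr0 big_distrr/=.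
  by apply: eq_bigr => i _; rewrite /bump/= add1n; ring.
- by rewrite big_distrr/=; apply: eq_bigr => i _; ring.
Qed.

(** Product rule on the recursion. A mean of successive differences of [g] thus has an explicit
    primitive, which gives integrals as well as continuity. At m = 0 the factor m hides the
    conventional value of [m.-1]. *)
Lemma is_derive_binomial_mean m g q :
  is_derive q 1 (binomial_mean m g)
    (m%:R * binomial_mean m.-1 (fun k => g k - g k.+1) q).
Proof.
elim: m g => [|m IH] g /=.
  by rewrite mul0r; exact: is_derive_cst.
have Hg := IH g; have HgS := IH (g \o succn).
apply: is_derive_eq.
rewrite /GRing.scale/= !mulr1 -/(comp _ _).
case: m {IH Hg HgS} => [|m] /=; first by rewrite !mul0r; ring.
rewrite [X in _ = X * _]mulrS -/(comp _ _).
have -> : binomial_mean m (fun k => (g \o succn) k - (g \o succn) k.+1) q =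
  binomial_mean m ((fun k => g k - g k.+1) \o succn) q by [].
set b := binomial_mean.
have E := binomial_meanB m g (g \o succn) q.
have E' := binomial_meanB m (g \o succn) (g \o succn \o succn) q.
move: E E'; rewrite -/b.
set b1 := b m g q; set b2 := b m (g \o succn) q.
set b3 := b m (g \o succn \o succn) q.
rewrite -[(g \- _)]/(fun k => g k - g k.+1) => E E'.
have -> : b m ((fun k => g k - g k.+1) \o succn) q = b2 - b3 by [].
rewrite E; ring.
Qed.

Lemma continuous_binomial_mean m g : continuous (binomial_mean m g).
Proof.
move=> q; apply/differentiable_continuous/derivable1_diffP.
exact: (@ex_derive _ _ _ _ _ _ _ (is_derive_binomial_mean m g q)).
Qed.

End binomial_mean.

(** Abel summation as an induction: the partial sums of [d] are nonnegative, so multiplying them by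
    the next, smaller value of [K] only lowers the bound; at the last index the bound is 0 because
    [d] has total sum 0. *)
Lemma abel_sum_ge0 (R : realType) (n : nat) (d K : nat -> R) :
  (forall m, (m <= n)%N -> 0 <= \sum_(k < m) d k) -> \sum_(k < n) d k = 0 ->
  (forall k, (k.+1 < n)%N -> K k.+1 <= K k) ->
  0 <= \sum_(k < n) d k * K k.
Proof.
move=> D0 Dn nK.
have key m : (m < n)%N ->
    (\sum_(k < m.+1) d k) * K m <= \sum_(k < m.+1) d k * K k.
  elim: m => [|m IH] mn; first by rewrite !big_ord1.
  rewrite big_ord_recr [leRHS]big_ord_recr/= mulrDl lerD2r.
  apply: le_trans (IH (ltnW mn)); apply: ler_wpM2l; last exact: nK.
  exact/D0/ltnW.
case: n D0 Dn nK key => [|n] D0 Dn nK key; first by rewrite big_ord0.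
by have := key _ (ltnSn n); rewrite Dn mul0r.
Qed.

Section convexity.
Variable R : realType.

(** Convexity with a bare real coefficient t, instead of the interval-typed one of
    [convex_function]. *)
Definition convex_on (A : set R) (f : R -> R) :=
  forall t x y, A x -> A y -> 0 <= t <= 1 ->
  f (t * x + (1 - t) * y) <= t * f x + (1 - t) * f y.

Lemma convex_functionW (A : set R) (f : R -> R) :
  convex_function A f -> convex_on A f.
Proof.
move=> cf t x y Ax Ay t01.
have t01' : Itv.spec (@Itv.num_sem R) (Itv.Real `[0%Z, 1%Z]) t.
  by rewrite /= /Itv.num_sem/= ger0_real//= ?in_itv//=; case/andP: t01.
have := cf (Itv.mk t01') x y.
by rewrite !inE => /(_ Ax Ay).
Qed.

(** The point b is the mean of a and c with weights (c - b) / (c - a) and (b - a) / (c - a). Slopes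
    are compared after cross-multiplication. *)
Lemma convex_on_slope (a b c : R) (A : set R) (f : R -> R) :
  convex_on A f -> A a -> A c -> a < b -> b < c ->
  (f b - f a) * (c - b) <= (f c - f b) * (b - a).
Proof.
move=> cf Aa Ac ab bc.
have ca : 0 < c - a by lra.
have := cf ((c - b) / (c - a)) a c Aa Ac.
have -> : 1 - (c - b) / (c - a) = (b - a) / (c - a) by field; lra.
have -> : (c - b) / (c - a) * a + (b - a) / (c - a) * c = b by field; lra.
rewrite divr_ge0 ?ler_pdivrMr//=; [|lra..].
have -> : (c - b) / (c - a) * f a + (b - a) / (c - a) * f c =
  ((c - b) * f a + (b - a) * f c) / (c - a) by field; lra.
rewrite ler_pdivlMr// => H.
have /H : c - b <= 1 * (c - a) by lra.
lra.
Qed.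

(** The witness is the right derivative, taken as the infimum of the slopes to the right of a;
    monotonicity bounds them below by 0, so the infimum exists even at a = 0. The point B is
    excluded since f may jump there. *)
Lemma subgradient (B a : R) (f : R -> R) :
  convex_on `[0, B]%classic f -> {in `[0, B] &, {homo f : x y / x <= y}} ->
  0 <= a < B -> exists h, forall b, 0 <= b <= B -> f a + h * (b - a) <= f b.
Proof.
move=> cf nf /andP[a0 aB].
pose S := [set (f c - f a) / (c - a) | c in `]a, B]%classic].
have S0 : S !=set0.
  by exists ((f B - f a) / (B - a)), B => //=; rewrite in_itv/= aB lexx.
have lbS : lbound S 0.
  move=> _ [c + <-]; rewrite /= in_itv/= => /andP[ac cB].
  rewrite divr_ge0//; last lra.
  by rewrite subr_ge0 nf ?in_itv/= ?(ltW ac)//; lra.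
have iS : has_inf S by split => //; exists 0.
exists (inf S) => b /andP[b0 bB].
have [ab|ba|<-] := ltgtP a b; last by rewrite subrr mulr0 addr0.
- rewrite -lerBrDl -ler_pdivlMr ?subr_gt0//; apply: ge_inf; first by case: iS.
  by exists b => //=; rewrite in_itv/= ab.
(* The slope from b to a is below every slope to the right of a. *)
- suff : (f a - f b) / (a - b) <= inf S.
    by rewrite ler_pdivrMr ?subr_gt0//; lra.
  apply: lb_le_inf => //= _ [c + <-]; rewrite /= in_itv/= => /andP[ac cB].
  rewrite ler_pdivrMr ?subr_gt0// mulrAC ler_pdivlMr ?subr_gt0//.
  by apply: (convex_on_slope cf) => //=; rewrite in_itv/=; lra.
Qed.

End convexity.

(** * Laws on the line *)

Section laws_on_the_line.
Variable R : realType.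
Local Notation mR := (measurableTypeR R).
Implicit Types P Q : probability mR R.

Lemma probability_ocE P (a b : R) : a <= b ->
  P `]a, b]%classic = (P `]-oo, b]%classic - P `]-oo, a]%classic)%E.
Proof.
move=> ab.
have -> : `]a, b]%classic = `]-oo, b]%classic `\` `]-oo, a]%classic :> set R.
  by rewrite -[RHS]setCK setCD setCitvl setUC -[LHS]setCK setCitv.
rewrite measureD ?setIidr//; first exact: subset_itvl.
by rewrite -ge0_fin_numE// fin_num_measure.
Qed.

(** The intervals ]a, b] are stable under intersection, generate the Borel sets and exhaust the
    line. *)
Lemma eq_law P Q : (forall t : R, P `]-oo, t]%classic = Q `]-oo, t]%classic) ->
  forall A, measurable A -> P A = Q A.
Proof.
move=> PQ A mA; apply: (@measure_unique _ R mR (@ocitv R)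
    (fun k => `](- k%:R), k%:R]%classic)) => //.
- exact: ocitvI.
- by move=> i; exact: is_ocitv.
- exact: bigcup_itvT.
- move=> _ [[a b] /= _ <-].
  have [ab|/ltW ba] := leP a b; last first.
    by rewrite set_itv_ge ?measure0// bnd_simp -leNgt.
  by rewrite !probability_ocE// !PQ.
- by move=> k; rewrite (le_lt_trans (probability_le1 _ _))// ltry.
Qed.

(** Continuity from below along the half-lines ending at s - 1 / (n + 1). *)
Lemma probability_Nyo_le P (s : R) (t : \bar R) :
  (forall y : R, y < s -> (P `]-oo, y]%classic <= t)%E) ->
  (P `]-oo, s[%classic <= t)%E.
Proof.
move=> Pt.
have -> : `]-oo, s[%classic = \bigcup_n `]-oo, s - n.+1%:R^-1]%classic :> set R.
  apply/seteqP; split=> [x|x [n _]]; rewrite /= !in_itv/=.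
    move=> xs; exists (Num.truncn (s - x)^-1) => //=; rewrite in_itv/=.
    rewrite lerBrDr -lerBrDl invf_ple ?posrE ?subr_gt0 ?ltr0n//.
    exact/ltW/Num.Theory.truncnS_gt.
  by move/le_lt_trans; apply; rewrite ltrBlDr ltrDl invr_gt0.
have /cvg_lim <- // : P `]-oo, s - n.+1%:R^-1]%classic @[n --> \oo] -->
    P (\bigcup_n `]-oo, s - n.+1%:R^-1]%classic).
  apply: nondecreasing_cvg_mu => //; first exact: bigcup_measurable.
  move=> m n mn; apply/subsetPset/subset_itvl.
  by rewrite bnd_simp lerD2l lerN2 lef_pV2 ?posrE ?ltr0n// ler_nat.
apply: lime_le; last first.
  by near=> n; apply: Pt; rewrite ltrBlDr ltrDl invr_gt0.
apply: ereal_nondecreasing_is_cvgn => m n mn.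
apply: le_measure; rewrite ?inE//; apply/subset_itvl.
by rewrite bnd_simp lerD2l lerN2 lef_pV2 ?posrE ?ltr0n// ler_nat.
Unshelve. all: by end_near. Qed.

Lemma bounded_integrable d (T : measurableType d) (P : probability T R)
    (f : T -> R) (a b : R) :
  measurable_fun setT f -> (forall x, a <= f x <= b) ->
  P.-integrable setT (EFin \o f).
Proof.
move=> mf fab; apply: measurable_bounded_integrable => //.
  by rewrite (le_lt_trans (probability_le1 _ _)) ?ltry.
exists (Num.max `|a| `|b|); split; first exact: num_real.
move=> M ltM x _ /=; apply: le_trans (ltW ltM).
have /andP[af fb] := fab x; rewrite le_max.
have := ler_norm b; have := ler_norm (- a); rewrite normrN.
by case: (ler0P (f x)) => _ ? ?; apply/orP; [left|right]; lra.
Qed.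

End laws_on_the_line.

(** * Cdfs and laws carried by [0, 1] *)

Section cdf01_law.
Variable R : realType.
Local Notation mR := (measurableTypeR R).
Implicit Types F : cdf01 R.

Lemma dcdf_Nyc F (x : R) : dcdf F `]-oo, x]%classic = (F x)%:E.
Proof. exact: (cdf_lebesgue_stieltjes_id F x). Qed.

Lemma cdf01_homo F : {homo F : x y / x <= y}.
Proof. exact: cumulative_is_nondecreasing. Qed.

Lemma cdf01_ge0 F (x : R) : 0 <= F x.
Proof. by rewrite -lee_fin -dcdf_Nyc. Qed.

Lemma cdf01_le1 F (x : R) : F x <= 1.
Proof. by rewrite -lee_fin -dcdf_Nyc probability_le1. Qed.

Lemma cdf01_ge1 F (x : R) : 1 <= x -> F x = 1.
Proof.
move=> x1; apply/eqP; rewrite eq_le cdf01_le1/= -[leLHS](cdf01_1 F).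
exact: cdf01_homo.
Qed.

Lemma dcdf01 F : dcdf F `[0, 1]%classic = 1%E.
Proof. by rewrite dcdf_itv// cdf01_1. Qed.

Lemma dcdf_setC01 F : dcdf F (~` `[0, 1]%classic) = 0%E.
Proof.
have := @probability_setC _ mR R (dcdf F) _ (measurable_itv `[0, 1]).
by rewrite dcdf01 subee.
Qed.

Lemma measurable_cdf01 F : measurable_fun setT (F : mR -> mR).
Proof. by apply: nondecreasing_measurable => //; exact: cdf01_homo. Qed.

HB.instance Definition _ F :=
  isMeasurableFun.Build _ _ _ _ (F : mR -> mR) (measurable_cdf01 F).

(** Deviations are built as probability measures; this turns them back into strategies. *)
Lemma cdf01_of_law (P : probability mR R) : P `[0, 1]%classic = 1%E ->
  exists F : cdf01 R, forall A, measurable A -> dcdf F A = P A.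
Proof.
move=> P01.
pose f (r : R) := fine (P `]-oo, r]%classic).
have fE r : (f r)%:E = P `]-oo, r]%classic by rewrite /f fineK// fin_num_measure.
have P0 (A : set mR) : measurable A -> A `<=` ~` `[0, 1]%classic -> P A = 0%E.
  move=> mA A01; apply/eqP; rewrite eq_le measure_ge0 andbT.
  have <- : P (~` `[0, 1]%classic) = 0%E.
    have := @probability_setC _ mR R P _ (measurable_itv `[0, 1]).
    by rewrite P01 subee.
  by apply: le_measure; rewrite ?inE//; exact: measurableC.
have f_lt0 x : x < 0 -> f x = 0.
  move=> x0; apply/EFin_inj; rewrite fE P0// => y /=; rewrite !in_itv/= => yx.
  by case/andP => y0 _; move: (le_lt_trans (le_trans y0 yx) x0); rewrite ltxx.
have f_ge1 x : 1 <= x -> f x = 1.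
  move=> x1; apply/EFin_inj; rewrite fE.
  apply/eqP; rewrite eq_le probability_le1//= -P01.
  apply: le_measure; rewrite ?inE// => y /=; rewrite !in_itv/= => /andP[_ y1].
  exact: le_trans x1.
have f_homo : {homo f : x y / x <= y}.
  move=> x y xy; rewrite -lee_fin !fE; apply: le_measure; rewrite ?inE//.
  exact: subset_itvl.
have f_rc : right_continuous f.
  (* [f] is the cdf of the identity random variable under P, hence right continuous. *)
  pose idT : mR -> R := idfun.
  pose mid := isMeasurableFun.Build _ _ _ _ idT (@measurable_id _ _ setT).
  pose X : {RV P >-> R} := HB.pack idT mid.
  move=> a; apply: fine_cvg; rewrite /= fineK ?fin_num_measure//.
  exact: (@cdf_right_continuous _ _ _ P X a).
have fNy : f @ -oo --> (0 : R).
  apply: cvg_near_cst; near=> x; apply: f_lt0; near: x; exact: nbhs_ninfty_lt.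
have fy : f @ +oo --> (1 : R).
  apply: cvg_near_cst; near=> x; apply: f_ge1; near: x; exact: nbhs_pinfty_ge.
pose m1 := isCumulative.Build R _ R f f_homo f_rc.
pose c1 : cumulative R R := HB.pack f m1.
pose m2 := isCumulativeBounded.Build R 0 1 f fNy fy.
pose c2 : cumulativeBounded (0:R) (1:R) := HB.pack f m1 m2.
have f1 : c2 1 = 1 by exact: f_ge1.
exists (@Cdf01 R c2 f_lt0 f1); apply: eq_law => t.
by rewrite dcdf_Nyc fE.
Unshelve. all: by end_near. Qed.

(** Projection on [0, 1]. Composing with it extends a function controlled only on [0, 1] to a
    bounded measurable function on the line, without changing it almost everywhere for a law carried
    by [0, 1]. *)
Definition clamp01 (x : R) : R := Num.max 0 (Num.min 1 x).

Lemma clamp01_itv x : 0 <= clamp01 x <= 1.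
Proof. by rewrite /clamp01 le_max lexx/= ge_max ler01/= ge_min lexx. Qed.

Lemma clamp01_id x : 0 <= x <= 1 -> clamp01 x = x.
Proof. by case/andP=> x0 x1; rewrite /clamp01 (min_idPr x1) (max_idPr x0). Qed.

Lemma clamp01_homo : {homo clamp01 : x y / x <= y}.
Proof.
by move=> x y xy; apply: le_max2 => //; exact: le_min2.
Qed.

Lemma homo_clamp01 (u : R -> R) : {in `[0, 1] &, {homo u : x y / x <= y}} ->
  {homo u \o clamp01 : x y / x <= y}.
Proof.
move=> nu x y xy /=; apply: nu; rewrite ?in_itv/= ?clamp01_itv//.
exact: clamp01_homo.
Qed.

Lemma measurable_clamp01 (u : R -> R) :
  {in `[0, 1] &, {homo u : x y / x <= y}} ->
  measurable_fun setT (u \o clamp01 : mR -> R).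
Proof.
by move=> nu; apply: nondecreasing_measurable => //; exact: homo_clamp01.
Qed.

Lemma clamp01_bounds (u : R -> R) : {in `[0, 1] &, {homo u : x y / x <= y}} ->
  forall x, u 0 <= (u \o clamp01) x <= u 1.
Proof.
move=> nu x; have /andP[? ?] := clamp01_itv x.
by rewrite !nu// ?in_itv/= ?lexx ?ler01 ?clamp01_itv.
Qed.

Lemma integral_clamp01 F (u : R -> R) :
  {in `[0, 1] &, {homo u : x y / x <= y}} ->
  (\int[dcdf F]_(x in `[0%R, 1%R]) (u x)%:E = \int[dcdf F]_x ((u \o clamp01) x)%:E)%E.
Proof.
move=> nu.
transitivity (\int[dcdf F]_(x in `[0%R, 1%R]) ((u \o clamp01) x)%:E)%E.
  apply: eq_integral => x; rewrite inE/= in_itv/= => x01.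
  by rewrite clamp01_id.
have mu := measurable_clamp01 nu.
have iu := bounded_integrable (dcdf F) mu (clamp01_bounds nu).
have mC : measurable (~` `[0, 1]%classic : set mR) by exact: measurableC.
have := negligible_integral mC measurableT iu (dcdf_setC01 F).
by rewrite setDE setCK setTI.
Qed.

End cdf01_law.

(** * Mixtures with a point mass; the probability integral transform *)

Section transport.
Variable R : realType.
Local Notation mR := (measurableTypeR R).

(** The witness is (1 - t) P + t delta_a, described by its integrals, which is how payoffs and costs
    see it. *)
Lemma mixture_law (P : probability mR R) (a t : R) : 0 <= t <= 1 ->
  exists Q : probability mR R, forall f : mR -> \bar R,
    measurable_fun setT f -> (forall x, 0 <= f x)%E ->
    (\int[Q]_x f x = (1 - t)%:E * \int[P]_x f x + t%:E * f a)%E.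
Proof.
move=> /andP[t0 t1]; have t1' : 0 <= 1 - t by rewrite subr_ge0.
pose m1 : {measure set mR -> \bar R} := mscale (NngNum t1') P.
pose m2 : {measure set mR -> \bar R} := mscale (NngNum t0) (@dirac _ mR a R).
pose Q : set mR -> \bar R := measure_add m1 m2.
have QT : Q setT = 1%E.
  have PT : P setT = 1%E := probability_setT P.
  transitivity ((1 - t)%:E * P setT + t%:E * (@dirac _ mR a R) setT)%E.
    by rewrite [LHS]measure_addE.
  by rewrite PT diracT !mule1 -EFinD subrK.
pose mQ := @Measure_isProbability.Build _ _ _ Q QT.
pose cQ := Measure.class (measure_add m1 m2 : {measure set mR -> \bar R}).
pose Q' : probability mR R := HB.pack Q cQ mQ.
exists Q' => f mf f0.
rewrite (_ : (\int[Q']_x f x = \int[measure_add m1 m2]_x f x)%E)//.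
rewrite ge0_integral_measure_add// !ge0_integral_mscale//=.
by rewrite integral_dirac// diracT mul1e.
Qed.

(** Integrating the indicator of [0, 1] shows that the mixture is still carried by [0, 1]. *)
Lemma mixture_cdf01 (F : cdf01 R) (a t : R) : 0 <= t <= 1 -> 0 <= a <= 1 ->
  exists H : cdf01 R, forall f : mR -> \bar R,
    measurable_fun setT f -> (forall x, 0 <= f x)%E ->
    (\int[dcdf H]_x f x = (1 - t)%:E * \int[dcdf F]_x f x + t%:E * f a)%E.
Proof.
move=> t01 a01; have [Q QE] := mixture_law (dcdf F) a t01.
have [|H HQ] := @cdf01_of_law _ Q.
  have mf : measurable_fun setT (fun x : mR => (\1_`[0, 1] x : R)%:E).
    exact/measurable_EFinP/measurable_indic.
  have := QE _ mf; rewrite !integral_indic// !setIT => ->; last first.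
    by move=> x; rewrite lee_fin.
  rewrite [X in (_ * X + _)%E]dcdf01 indicE mem_set//= ?in_itv//=.
  by rewrite !mule1 -EFinD subrK.
exists H => f mf f0; rewrite -QE//.
by apply: eq_measure_integral => A mA _; exact: HQ.
Qed.

Definition uniform01 : probability mR R := uniform_prob (@ltr01 R).

Lemma uniform01_Nyc (t : R) :
  uniform01 `]-oo, t]%classic = (clamp01 t)%:E.
Proof.
transitivity (\int[lebesgue_measure]_(x in `]-oo, t]) (uniform_pdf 0 1 x)%:E)%E.
  by [].
rewrite integral_uniform_pdf.
rewrite (eq_integral (cst 1%E)); last first.
  move=> x; rewrite inE/= /uniform_pdf => -[_]; rewrite in_itv/= => ->.
  by rewrite subr0 invr1.
rewrite integral_cst ?mul1e//; last exact: measurableI.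
have -> : `]-oo, t]%classic `&` `[0, 1]%classic =
    `[0, Num.min 1 t]%classic :> set R.
  apply/seteqP; split=> x /=; rewrite !in_itv/= le_min.
    by case=> -> /andP[-> ->].
  by case/and3P => -> -> ->.
have := lebesgue_measure_itv `[0, Num.min 1 t]; rewrite /= lte_fin => ->.
rewrite /clamp01; case: ltP => _ //; by rewrite sube0.
Qed.

Lemma dcdf_Nyo (F : cdf01 R) (x : R) : dcdf F [set x] = 0%E ->
  dcdf F `]-oo, x[%classic = (F x)%:E.
Proof.
move=> Fx; rewrite -dcdf_Nyc.
have -> : `]-oo, x]%classic = `]-oo, x[%classic `|` [set x] :> set R.
  by rewrite setUitv1.
rewrite measureU//=.
  by rewrite [X in (_ + X)%E]Fx adde0.
apply/seteqP; split=> // y [/=]; rewrite in_itv/= => yx yE.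
by move: yx; rewrite yE ltxx.
Qed.

(** For 0 <= t < 1 let s be the supremum of S = {F <= t}. Then S lies between ]-oo, s[ and ]-oo, s],
    which have the same mass F(s) as s is no atom; so it suffices that F(s) = t. *)
Lemma probability_integral_transform (F : cdf01 R) :
  (forall x, dcdf F [set x] = 0%E) -> forall A, measurable A ->
  distribution (dcdf F) (F : mR -> mR) A = uniform01 A.
Proof.
move=> Fx; apply: eq_law => t; rewrite uniform01_Nyc.
pose S : set mR := [set x | F x <= t].
rewrite [LHS](_ : _ = dcdf F S); last first.
  by congr (dcdf F _); apply/seteqP; split => x; rewrite /S/= in_itv.
have [t1|t1] := leP 1 t.
  rewrite (_ : S = setT) ?probability_setT.
    by rewrite /clamp01 (min_idPl t1) (max_idPr ler01).
  by apply/seteqP; split => // x _; rewrite /S/= (le_trans (cdf01_le1 F x)).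
have [t0|t0] := ltP t 0.
  rewrite (_ : S = set0) ?measure0.
    by rewrite /clamp01 (min_idPr (ltW t1)) (max_idPl (ltW t0)).
  apply/seteqP; split => // x; rewrite /S/= => Fxt.
  by have := le_lt_trans (le_trans (cdf01_ge0 F x) Fxt) t0; rewrite ltxx.
rewrite clamp01_id ?t0 ?(ltW t1)//.
have SE x : S x = (F x <= t) by [].
have S1 : ubound S 1.
  move=> x; rewrite SE leNgt => Fxt; rewrite leNgt; apply/negP => x1.
  by move: Fxt; rewrite cdf01_ge1 ?t1// ltW.
have hS : has_sup S.
  by split; [exists (-1); rewrite SE (cdf01_lt0 F)// ltrN10|exists 1].
pose s := sup S.
have ltS y : y < s -> S y.
  move=> /sup_gt-/(_ hS.1) [z Sz yz]; rewrite SE.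
  by move: Sz; rewrite SE; apply: le_trans; exact/cdf01_homo/ltW.
have mS : measurable (S : set mR).
  have := @measurable_cdf01 R F measurableT _ (measurable_itv `]-oo, t]).
  rewrite setTI; suff -> : S = (F : mR -> mR) @^-1` `]-oo, t] by [].
  by apply/seteqP; split => x; rewrite /S/= in_itv.
have oS : dcdf F `]-oo, s[%classic = dcdf F `]-oo, s]%classic.
  by rewrite dcdf_Nyc dcdf_Nyo.
have le1 : (dcdf F `]-oo, s]%classic <= dcdf F S)%E.
  by rewrite -oS; apply: le_measure; rewrite ?inE.
have le2 : (dcdf F S <= dcdf F `]-oo, s]%classic)%E.
  apply: le_measure; rewrite ?inE// => y Sy; rewrite /= in_itv/=.
  exact: (ub_le_sup hS.2 Sy).
have -> : dcdf F S = dcdf F `]-oo, s]%classic by apply/eqP; rewrite eq_le le1 le2.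
(* F <= t to the left of s bounds the mass of ]-oo, s[ by t; F > t to the right of s gives F(s) >= t
   by right continuity. *)
apply/eqP; rewrite eq_le -[in X in X && _]oS; apply/andP; split.
  by apply: probability_Nyo_le => y /ltS; rewrite SE dcdf_Nyc lee_fin.
rewrite dcdf_Nyc lee_fin.
have : F y @[y --> s^'+] --> F s by exact: cumulative_is_right_continuous.
move=> /cvg_lim <- //; apply: limr_ge.
  by apply: cvgP; exact: cumulative_is_right_continuous.
near=> y; have : ~ S y.
  by move=> /(ub_le_sup hS.2); apply/negP; rewrite -ltNge; near: y; exact: nbhs_right_gt.
by rewrite SE => /negP; rewrite -ltNge => /ltW.
Unshelve. all: by end_near. Qed.

End transport.

(** * Convex order of the prize distributions *)

Section bounded_measurable.
Variable R : realType.
Local Notation mR := (measurableTypeR R).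
Implicit Types f g : mR -> R.

(** A class closed under sums, differences and products and integrable for every probability, so
    that integrability conditions follow from the shape of the integrand. *)
Definition bounded_measurable f :=
  measurable_fun setT f /\ exists M, forall x, `|f x| <= M.

Lemma bounded_measurable_integrable (P : probability mR R) f :
  bounded_measurable f -> P.-integrable setT (EFin \o f).
Proof.
move=> [mf [M fM]]; apply: (@bounded_integrable R _ _ P f (- M) M) => // x.
by rewrite -ler_norml.
Qed.

Lemma bounded_measurable_cst (c : R) : bounded_measurable (fun=> c).
Proof. by split; [exact: measurable_cst|exists `|c|]. Qed.

Lemma bounded_measurableD f g : bounded_measurable f -> bounded_measurable g ->
  bounded_measurable (fun x => f x + g x).
Proof.
move=> [mf [M fM]] [mg [N gN]]; split; first exact: measurable_funD.
by exists (M + N) => x; rewrite (le_trans (ler_normD _ _))// lerD.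
Qed.

Lemma bounded_measurableM f g : bounded_measurable f -> bounded_measurable g ->
  bounded_measurable (fun x => f x * g x).
Proof.
move=> [mf [M fM]] [mg [N gN]]; split; first exact: measurable_funM.
by exists (M * N) => x; rewrite normrM ler_pM.
Qed.

Lemma bounded_measurableB f g : bounded_measurable f -> bounded_measurable g ->
  bounded_measurable (fun x => f x - g x).
Proof.
move=> [mf [M fM]] [mg [N gN]]; split; first exact: measurable_funB.
by exists (M + N) => x; rewrite (le_trans (ler_normB _ _))// lerD.
Qed.

Lemma bounded_measurable_homo (u : R -> R) :
  {in `[0, 1] &, {homo u : x y / x <= y}} ->
  bounded_measurable (u \o clamp01 (R := R)).
Proof.
move=> nu; split; first exact: measurable_clamp01.
exists (`|u 0| + `|u 1|) => x.
have /andP[] := clamp01_bounds nu x.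
have := ler_norm (u 1); have := ler_norm (- u 0); rewrite normrN.
by have := normr_ge0 (u 0); have := normr_ge0 (u 1); rewrite ler_norml; lra.
Qed.

Lemma measurable_clamp01_continuous (f : R -> R) : continuous f ->
  measurable_fun setT (f \o clamp01 (R := R) : mR -> R).
Proof.
move=> cf; apply: measurableT_comp; first exact: continuous_measurable_fun.
by apply: (@measurable_clamp01 R id).
Qed.

Lemma bounded_measurable_continuous (f : R -> R) : continuous f ->
  bounded_measurable (f \o clamp01 (R := R)).
Proof.
move=> cf; split; first exact: measurable_clamp01_continuous.
have cw : {within `[0, 1], continuous f} by exact: continuous_subspaceT.
have [c _ fc] := EVT_max ler01 cw; have [e _ fe] := EVT_min ler01 cw.
exists (`|f c| + `|f e|) => x.
have x01 : clamp01 x \in `[0, 1] by rewrite in_itv/= clamp01_itv.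
have := fc _ x01; have := fe _ x01 => /=.
have := ler_norm (f c); have := ler_norm (- f e); rewrite normrN.
by have := normr_ge0 (f c); have := normr_ge0 (f e); rewrite ler_norml; lra.
Qed.

End bounded_measurable.

(** * Bernstein polynomials under the uniform law *)

Section uniform_binomial.
Variable R : realType.
Local Notation mR := (measurableTypeR R).

(** Fundamental theorem of calculus: the integrand is the derivative of [binomial_mean m.+1 g]
    divided by m + 1, whose values at 1 and 0 are those of [g] at 0 and m + 1, divided by m + 1.
    Monotonicity of [g] makes the integrand nonnegative. *)
Lemma integral_uniform_binomial_mean m (g : nat -> R) :
  {homo g : i j / (i <= j)%N >-> j <= i} ->
  (\int[@uniform01 R]_x
    (binomial_mean m (fun k => g k - g k.+1) (clamp01 x))%:E =
   ((g 0%N - g m.+1) / m.+1%:R)%:E)%E.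
Proof.
move=> ng; pose f := binomial_mean m (fun k => g k - g k.+1).
pose Q q := m.+1%:R^-1 * binomial_mean m.+1 g q.
have dQ (q : R) : is_derive q 1 Q (f q).
  have H := is_derive_binomial_mean m.+1 g q.
  rewrite /Q; apply: is_derive_eq.
  by rewrite /GRing.scale/= mulrA mulVf ?pnatr_eq0// mul1r.
have cQ : continuous Q.
  move=> q; apply/differentiable_continuous/derivable1_diffP.
  exact: (@ex_derive _ _ _ _ _ _ _ (dQ q)).
have mf : measurable_fun setT (fun x : mR => (f (clamp01 x))%:E).
  apply/measurable_EFinP.
  exact: (measurable_clamp01_continuous (@continuous_binomial_mean R m _)).
rewrite (integral_uniform _ mf) => [|x]; last first.
  rewrite lee_fin binomial_mean_ge0 ?clamp01_itv// => k _.
  by rewrite subr_ge0 ng.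
rewrite subr0 invr1 mul1e.
transitivity (\int[lebesgue_measure]_(x in `[0%R, 1%R]) (f x)%:E)%E.
  apply: eq_integral => x; rewrite inE/= in_itv/= => x01.
  by rewrite clamp01_id.
rewrite (@continuous_FTC2 _ f Q)//.
- by rewrite /Q binomial_mean_1 binomial_mean_0 -EFinB; congr EFin; ring.
- exact/continuous_subspaceT/continuous_binomial_mean.
- split => [x _||].
  + exact: (@ex_derive _ _ _ _ _ _ _ (dQ x)).
  + exact: cvg_at_right_filter (cQ 0).
  + exact: cvg_at_left_filter (cQ 1).
- by move=> x _; rewrite derive1E; exact: derive_val.
Qed.

(** For [g] the indicator of k <= j, the difference g k - g k.+1 is the indicator of k = j. *)
Lemma Rintegral_uniform_bernstein m j : (j <= m)%N ->
  \int[@uniform01 R]_x bernstein m j (clamp01 x) = m.+1%:R^-1.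
Proof.
move=> jm; pose g k : R := (k <= j)%:R.
have ng : {homo g : i k / (i <= k)%N >-> k <= i}.
  move=> i k ik; rewrite /g ler_nat.
  by case: (leqP k j) => // /(leq_trans ik) ->.
have := integral_uniform_binomial_mean m ng.
rewrite /g leq0n ltnNge jm /= subr0 mul1r => E.
rewrite -[RHS]/(fine (m.+1%:R^-1)%:E) -E; congr fine.
apply: eq_integral => x _; congr EFin; rewrite binomial_meanE.
rewrite (bigD1 (Ordinal (jm : (j < m.+1)%N)))//= leqnn ltnn subr0 mul1r.
rewrite big1 ?addr0// => i /eqP ij.
have : nat_of_ord i != j by apply/eqP => ij'; apply: ij; exact/val_inj.
by case: ltngtP => // _ _; rewrite subrr mul0r.
Qed.

Lemma continuous_bernstein m j : continuous (bernstein m j : R -> R).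
Proof.
move=> q; rewrite /bernstein; apply: cvgM.
  by apply: cvgM; [exact: cvg_cst|exact: exprn_continuous].
apply: (continuous_comp (f := fun q : R => 1 - q) (g := fun q => q ^+ j)).
  by apply: cvgB; [exact: cvg_cst|exact: cvg_id].
exact: exprn_continuous.
Qed.

(** The difference b_(j+1) - b_j is a nonnegative factor times t0 - t, and has integral 0. Replacing
    k(t) by k(t0) can therefore only increase its weighted integral, which becomes 0. *)
Lemma Rintegral_bernstein_homo m j (k : R -> R) : (j < m)%N ->
  {in `[0, 1] &, {homo k : x y / x <= y}} ->
  \int[@uniform01 R]_x (k (clamp01 x) * bernstein m j.+1 (clamp01 x)) <=
  \int[@uniform01 R]_x (k (clamp01 x) * bernstein m j (clamp01 x)).
Proof.
move=> jm nk.
have bk := bounded_measurable_homo nk.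
have bb i := bounded_measurable_continuous (@continuous_bernstein m i).
pose A : R := 'C(m, j.+1)%:R; pose B : R := 'C(m, j)%:R.
have A0 : 0 < A by rewrite ltr0n bin_gt0.
have B0 : 0 < B by rewrite ltr0n bin_gt0 ltnW.
(* The zero of A (1 - t) - B t, where b_(j+1) and b_j cross. *)
pose t0 := A / (A + B).
have t01 : t0 \in `[0, 1].
  by rewrite in_itv/= divr_ge0 ?ler_pdivrMr//=; lra.
have cross t : t \in `[0, 1] ->
    k t * bernstein m j.+1 t - k t * bernstein m j t <=
    k t0 * bernstein m j.+1 t - k t0 * bernstein m j t.
  move=> t01'; have := t01'; rewrite in_itv/= => /andP[t0' t1'].
  rewrite -!mulrBr.
  pose c := t ^+ (m - j.+1) * (1 - t) ^+ j.
  have c0 : 0 <= c by rewrite mulr_ge0 ?exprn_ge0// subr_ge0.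
  have -> : bernstein m j.+1 t - bernstein m j t = c * (A - t * (A + B)).
    by rewrite /bernstein /c -/A -/B -(subnSK jm) !exprS; ring.
  have -> : A - t * (A + B) = (t0 - t) * (A + B).
    by rewrite mulrBl /t0 divfK// gt_eqF// addr_gt0.
  rewrite -subr_ge0.
  have -> : k t0 * (c * ((t0 - t) * (A + B))) - k t * (c * ((t0 - t) * (A + B)))
    = c * ((k t0 - k t) * (t0 - t)) * (A + B) by ring.
  rewrite mulr_ge0//; last by rewrite addr_ge0// ltW.
  rewrite mulr_ge0//.
  have [tt|/ltW tt] := leP t t0.
    by rewrite mulr_ge0// subr_ge0// nk.
  by rewrite mulr_le0// subr_le0// nk.
have ib i := bounded_measurable_integrable (uniform01 R) (bb i).
have ikb i := bounded_measurable_integrable (uniform01 R)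
  (bounded_measurableM bk (bb i)).
rewrite -subr_le0 -RintegralB//; last 2 first.
- exact: (ikb j.+1).
- exact: (ikb j).
have bt i := bounded_measurableM (bounded_measurable_cst (k t0)) (bb i).
have it i := bounded_measurable_integrable (uniform01 R) (bt i).
apply: (@le_trans _ _ (\int[@uniform01 R]_x
    (k t0 * bernstein m j.+1 (clamp01 x) - k t0 * bernstein m j (clamp01 x)))).
  apply: le_Rintegral => //.
  - apply: bounded_measurable_integrable.
    exact: (bounded_measurableB (bounded_measurableM bk (bb j.+1))
      (bounded_measurableM bk (bb j))).
  - apply: bounded_measurable_integrable.
    exact: (bounded_measurableB (bt j.+1) (bt j)).
  - by move=> x _; apply: cross; rewrite in_itv/= clamp01_itv.
rewrite RintegralB//; [|exact: (it j.+1)|exact: (it j)].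
rewrite !RintegralZl//; [|exact: (ib j)|exact: (ib j.+1)].
by rewrite !Rintegral_uniform_bernstein// ?subrr// ltnW.
Qed.

End uniform_binomial.

Lemma binomial_mean_itv (R : realType) m (g : nat -> R) (q : R) :
  0 <= q <= 1 -> (forall k, 0 <= g k <= 1) -> 0 <= binomial_mean m g q <= 1.
Proof.
move=> q01 g01; rewrite binomial_mean_ge0//=; last first.
  by move=> k _; case/andP: (g01 k).
rewrite -[leRHS](binomial_mean_cst m 1 q) le_binomial_mean// => k _.
by case/andP: (g01 k).
Qed.

Lemma integrable_sumR d (T : measurableType d) (R : realType)
    (P : {measure set T -> \bar R}) n (f : 'I_n -> T -> R) :
  (forall i, P.-integrable setT (EFin \o f i)) ->
  P.-integrable setT (EFin \o (fun x => \sum_(i < n) f i x)).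
Proof.
move=> fi; have := @integrable_sum _ _ _ P setT measurableT _
  (index_enum 'I_n) predT (fun i => EFin \o f i) (fun i _ => fi i).
by apply: eq_integrable => // x _; rewrite sumEFin.
Qed.

Lemma Rintegral_sum d (T : measurableType d) (R : realType)
    (P : {measure set T -> \bar R}) n (f : 'I_n -> T -> R) :
  (forall i, P.-integrable setT (EFin \o f i)) ->
  \int[P]_x (\sum_(i < n) f i x) = \sum_(i < n) \int[P]_x f i x.
Proof.
elim: n f => [|n IH] f fi.
  under eq_Rintegral do rewrite big_ord0.
  by rewrite big_ord0 Rintegral_cst// mul0r.
under eq_Rintegral do rewrite big_ord_recl.
rewrite big_ord_recl RintegralD//; last first.
  exact: integrable_sumR (fun i => fi (lift ord0 i)).
by rewrite IH.
Qed.

(** The subgradient of f at P_v(t), seen as a function [k] of t, is integrated against P_w - P_v. It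
    exists because the prizes stay below 1, hence away from the endpoint B. *)
Lemma convex_order_binomial_mean (R : realType) (N : nat) (v w : nat -> R)
    (B : R) (f : R -> R) :
  {homo v : i j / (i <= j)%N >-> j <= i} ->
  {homo w : i j / (i <= j)%N >-> j <= i} ->
  (forall k, 0 <= v k <= 1) -> (forall k, 0 <= w k <= 1) ->
  (forall m, (m <= N.+1)%N -> \sum_(k < m) v k <= \sum_(k < m) w k) ->
  \sum_(k < N.+1) w k = \sum_(k < N.+1) v k ->
  1 < B -> convex_on `[0, B]%classic f ->
  {in `[0, B] &, {homo f : x y / x <= y}} ->
  \int[@uniform01 R]_x f (binomial_mean N v (clamp01 x)) <=
  \int[@uniform01 R]_x f (binomial_mean N w (clamp01 x)).
Proof.
move=> nv nw v01 w01 vw eqvw B1 cf nf.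
have /choice[h hP] : forall a : R, exists h : R, 0 <= a <= 1 ->
    forall b : R, 0 <= b <= B -> f a + h * (b - a) <= f b.
  move=> a; have [a01|a01] := boolP (0 <= a <= 1); last by exists 0.
  have [|h hP] := @subgradient R B a f cf nf; last by exists h.
  by case/andP: a01 => -> a1; exact: le_lt_trans a1 B1.
have itvB (a : R) : 0 <= a <= 1 -> 0 <= a <= B.
  by case/andP => -> a1; rewrite (le_trans a1)// ltW.
have Pv (t : R) : t \in `[0, 1] -> 0 <= binomial_mean N v t <= 1.
  by rewrite in_itv/= => t01; exact: binomial_mean_itv.
have Pw (t : R) : t \in `[0, 1] -> 0 <= binomial_mean N w t <= 1.
  by rewrite in_itv/= => t01; exact: binomial_mean_itv.
pose k (t : R) : R := h (binomial_mean N v t).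
have nk : {in `[0, 1] &, {homo k : x y / x <= y}}.
  move=> x y x01 y01 xy; rewrite /k.
  have := binomial_mean_homo N nv x01 y01 xy.
  (* For a < b, adding the subgradient inequalities at a and at b gives (h b - h a) (b - a) >= 0. *)
  rewrite le_eqVlt => /predU1P[->//|ab].
  have := hP _ (Pv _ x01) _ (itvB _ (Pv _ y01)).
  have := hP _ (Pv _ y01) _ (itvB _ (Pv _ x01)).
  move: ab; set a := binomial_mean N v x; set b := binomial_mean N v y.
  nra.
have nfP u : {homo u : i j / (i <= j)%N >-> j <= i} ->
    (forall t, t \in `[0, 1] -> 0 <= binomial_mean N u t <= 1) ->
    {in `[0, 1] &, {homo f \o binomial_mean N u : x y / x <= y}}.
  move=> nu Pu x y x01 y01 xy /=; apply: nf; rewrite ?in_itv/= ?itvB ?Pu//.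
  exact: binomial_mean_homo.
have bk := bounded_measurable_homo nk.
have bfv := bounded_measurable_homo (nfP _ nv Pv).
have bfw := bounded_measurable_homo (nfP _ nw Pw).
have bb i := bounded_measurable_continuous (@continuous_bernstein R N i).
pose d j := w j - v j.
pose K j := \int[@uniform01 R]_x (k (clamp01 x) * bernstein N j (clamp01 x)).
have bkb i := bounded_measurableM bk (bb i).
have bdkb i := bounded_measurableM (bounded_measurable_cst (d i)) (bkb i).
have ikb i := bounded_measurable_integrable (uniform01 R) (bkb i).
have idkb i := bounded_measurable_integrable (uniform01 R) (bdkb i).
have ifv := bounded_measurable_integrable (uniform01 R) bfv.
have ifw := bounded_measurable_integrable (uniform01 R) bfw.
rewrite -subr_ge0 -RintegralB//.
(* Majorization makes the partial sums of [d] nonnegative, and the numbers [K j] decrease. *)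
apply: (@le_trans _ _ (\sum_(j < N.+1) d j * K j)).
  apply: abel_sum_ge0 => [m mN||j jN].
  - by rewrite sumrB subr_ge0 vw.
  - by rewrite sumrB eqvw subrr.
  - exact: Rintegral_bernstein_homo.
rewrite (_ : \sum_(j < N.+1) d j * K j = \int[@uniform01 R]_x (\sum_(j < N.+1)
    d j * (k (clamp01 x) * bernstein N j (clamp01 x)))); last first.
  rewrite (@Rintegral_sum _ _ _ (uniform01 R) N.+1 (fun (j : 'I_N.+1) x =>
    d j * (k (clamp01 x) * bernstein N j (clamp01 x)))).
    by apply: eq_bigr => j _; rewrite RintegralZl//; exact: (ikb j).
  by move=> i; exact: (idkb i).
apply: le_Rintegral => //.
- exact: (integrable_sumR (fun i : 'I_N.+1 => idkb i)).
- exact: (bounded_measurable_integrable (uniform01 R)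
    (bounded_measurableB bfw bfv)).
(* Pointwise this is the subgradient inequality, with P_w - P_v expanded in Bernstein
   polynomials. *)
- move=> x _; have x01 : clamp01 x \in `[0, 1] by rewrite in_itv/= clamp01_itv.
  have := hP _ (Pv _ x01) _ (itvB _ (Pw _ x01)).
  rewrite -/(k _) lerBrDl; apply: le_trans; rewrite lerD2l.
  rewrite (binomial_meanE N w) (binomial_meanE N v) -sumrB big_distrr/=.
  rewrite [leRHS](eq_bigr (fun j : 'I_N.+1 =>
    d j * (k (clamp01 x) * bernstein N j (clamp01 x))))// => j _.
  by rewrite /d; ring.
Qed.

(** * Rankings and expected prizes *)

Section contest_payoff.
Variable R : realType.
Local Notation mR := (measurableTypeR R).

(** Breaking ties by index gives a strict total order, and the number of players ahead is then an
    injective rank. This makes the denominator of [gross_payoff] nonzero. *)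
Lemma ranking_exists n (x : n.-tuple mR) : exists s, compatible_ranking x s.
Proof.
pose ahead (j i : 'I_n) := (tnth x i < tnth x j) ||
  ((tnth x i == tnth x j) && (j < i)%N).
pose r i := #|[pred j | ahead j i]|.
have aheadxx i : ahead i i = false by rewrite /ahead ltxx ltnn andbF.
have ahead_trans : transitive ahead.
  move=> j i k; rewrite /ahead => /orP[ji|/andP[/eqP <- ij]].
    move=> /orP[kj|/andP[/eqP -> _]]; first by rewrite (lt_trans kj ji).
    by rewrite ji.
  move=> /orP[->//|/andP[-> jk]]; by rewrite (ltn_trans ij jk) orbT.
have ahead_total i j : i != j -> ahead i j || ahead j i.
  move=> ij; rewrite /ahead; case: (ltgtP (tnth x i) (tnth x j)) => //= _.
  by case: ltngtP ij => // /val_inj ->; rewrite eqxx.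
have r_lt i j : ahead i j -> (r i < r j)%N.
  move=> ij; apply/proper_card/properP; split.
    by apply/fintype.subsetP => k; rewrite !inE => /ahead_trans; apply.
  by exists i; rewrite !inE ?ij// aheadxx.
have r_n i : (r i < n)%N.
  rewrite -[X in (_ < X)%N]card_ord ; apply/proper_card/properP.
  by split; [exact/fintype.subsetP|exists i; rewrite !inE ?aheadxx].
pose f i := Ordinal (r_n i).
have f_inj : injective f.
  move=> i j [rij]; apply/eqP/negPn/negP => /ahead_total.
  by case/orP => /r_lt; rewrite rij ltnn.
exists (perm f_inj); apply/forallP => i; apply/forallP => j; apply/implyP => ji.
by rewrite !permE /= r_lt// /ahead ji.
Qed.

Lemma card_perm_lt n (s : 'S_n) (i : 'I_n) : #|[pred j | (s j < s i)%N]| = s i.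
Proof.
rewrite -sum1_card; transitivity (\sum_(k < n | (k < s i)%N) 1)%N.
  by rewrite [RHS](reindex_inj (@perm_inj _ s)).
by rewrite big_ord_narrow ?sum1_card ?card_ord// ltnW.
Qed.

(** Exactly [s i] players are ranked ahead of i, and all strictly better ones are among them. The
    next lemma is the opposite bound: whoever is ranked ahead is at least as good. *)
Lemma compatible_ranking_ge n (x : n.-tuple mR) s i : compatible_ranking x s ->
  (#|[pred j | (tnth x i < tnth x j)%R]| <= s i)%N.
Proof.
move=> /forallP cs; rewrite -[leqRHS]card_perm_lt; apply/subset_leq_card.
apply/fintype.subsetP => j; rewrite !inE => ij.
by have /forallP/(_ i)/implyP := cs j; apply.
Qed.

Lemma compatible_ranking_le n (x : n.-tuple mR) s i : compatible_ranking x s ->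
  (s i <= #|[pred j | (j != i) && (tnth x i <= tnth x j)%R]|)%N.
Proof.
move=> /forallP cs; rewrite -[leqLHS]card_perm_lt; apply/subset_leq_card.
apply/fintype.subsetP => j; rewrite !inE => ji; apply/andP; split.
  by apply/eqP => ij; move: ji; rewrite ij ltnn.
rewrite leNgt; apply/negP => xji.
have /forallP/(_ j)/implyP/(_ xji) := cs i.
by rewrite ltnNge (ltnW ji).
Qed.

Lemma compatible_ranking_gt0 n (x : n.-tuple mR) :
  0 < #|compatible_ranking x|%:R :> R.
Proof.
by rewrite ltr0n; apply/card_gt0P; have [s cs] := ranking_exists x; exists s.
Qed.

Lemma gross_payoff_le n (v : n.-tuple R) (x : n.-tuple mR) i (c : R) :
  (forall s, compatible_ranking x s -> v`_(s i) <= c) ->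
  gross_payoff v i x <= c.
Proof.
move=> vc; rewrite /gross_payoff ler_pdivrMr ?compatible_ranking_gt0//.
by rewrite -sumr_const mulr_sumr; apply: ler_sum => s cs; rewrite mulr1 vc.
Qed.

Lemma gross_payoff_ge n (v : n.-tuple R) (x : n.-tuple mR) i (c : R) :
  (forall s, compatible_ranking x s -> c <= v`_(s i)) ->
  c <= gross_payoff v i x.
Proof.
move=> vc; rewrite /gross_payoff ler_pdivlMr ?compatible_ranking_gt0//.
by rewrite -sumr_const mulr_sumr; apply: ler_sum => s cs; rewrite mulr1 vc.
Qed.

(* Only one of the rankings that put the player second is accounted for, hence
   the crude factor 1 / n!. *)
Definition tie_loss n (v : n.-tuple R) : R := (v`_0 - v`_1) / #|{: 'S_n}|%:R.

Lemma gross_payoff_tie n (v : n.-tuple R) (x : n.-tuple mR) i :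
  (1 < n)%N -> {homo nth 0 v : i j / (i <= j)%N >-> j <= i} ->
  (forall j, tnth x j = tnth x i) ->
  gross_payoff v i x <= v`_0 - tie_loss v.
Proof.
move=> n1 nv xi.
have cx s : compatible_ranking x s.
  by apply/forallP => j; apply/forallP => k; rewrite !xi ltxx.
rewrite /gross_payoff /tie_loss (eq_card (B := 'S_n))//.
rewrite (eq_bigl predT)//.
have S0 : (0 : R) < #|{: 'S_n}|%:R.
  by rewrite ltr0n; apply/card_gt0P; exists 1%g.
rewrite ler_pdivrMr// mulrBl divfK ?gt_eqF// lerBrDl.
rewrite -lerBrDr -sumr_const mulr_sumr -sumrB.
(* A ranking that puts player i second; every other one gives at most the top prize. *)
pose s1 := tperm i (Ordinal n1).
rewrite (bigD1 s1)//= mulr1 tpermL /= lerDl sumr_ge0// => s _.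
by rewrite ?mulr1 subr_ge0 nv.
Qed.

End contest_payoff.

(** * Measurability of payoffs *)

Section measurability.
Variables (R : realType).
Local Notation mR := (measurableTypeR R).

(** A preimage is a finite union, over the patterns of outcomes of the tests, of finite
    intersections of measurable sets. Payoffs factor through pairwise comparisons, and counts
    through one test per opponent. *)
Lemma measurable_bool_factor d (T : measurableType d) (E : finType)
    (q : E -> T -> bool) (h : {ffun E -> bool} -> R) :
  (forall e, measurable [set x | q e x]) ->
  measurable_fun setT (fun x => h [ffun e => q e x]).
Proof.
move=> mq _ Y mY; rewrite setTI.
rewrite [X in measurable X](_ : _ = \bigcup_(b in [set b | Y (h b)])
    \bigcap_(e in [set: E]) [set x | q e x = b e]); last first.
  apply/seteqP; split => [x /= Yx|x [b Yb bx] /=].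
    by exists [ffun e => q e x] => // e _ /=; rewrite ffunE.
  suff -> : [ffun e => q e x] = b by [].
  by apply/ffunP => e; rewrite ffunE; exact: bx.
apply: fin_bigcup_measurable => [|b _]; first exact: finite_finset.
apply: fin_bigcap_measurable => [|e _]; first exact: finite_finset.
case: (b e); first exact: mq.
rewrite [X in measurable X](_ : _ = ~` [set x | q e x]).
  exact/measurableC/mq.
by apply/seteqP; split => x /=; [move/negbT/negP|move/negP/negbTE].
Qed.

Lemma measurable_gross_payoff n (v : n.-tuple R) i :
  measurable_fun setT (gross_payoff v i : n.-tuple mR -> R).
Proof.
pose h (b : {ffun 'I_n * 'I_n -> bool}) : R :=
  (\sum_(s : 'S_n | [forall i, forall j, b (j, i) ==> (s i < s j)%N]) v`_(s i))
  / #|[pred s : 'S_n | [forall i, forall j, b (j, i) ==> (s i < s j)%N]]|%:R.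
pose q (e : 'I_n * 'I_n) (x : n.-tuple mR) := tnth x e.1 < tnth x e.2.
have := @measurable_bool_factor _ _ _ q h.
rewrite (_ : (fun x => _) = gross_payoff v i).
  apply=> e; rewrite -[X in measurable X]setTI.
  by apply: measurable_fun_ltr => //; exact: measurable_tnth.
apply/funext => x; rewrite /h /gross_payoff; congr (_ / _%:R).
  apply: eq_bigl => s; apply: eq_forallb => j; apply: eq_forallb => k.
  by rewrite ffunE.
apply: eq_card => s; rewrite !inE; apply: eq_forallb => j.
by apply: eq_forallb => k; rewrite ffunE.
Qed.

Lemma measurable_count m (g : nat -> R) (p : pred R) :
  measurable ([set x | p x] : set mR) ->
  measurable_fun setT (fun y : m.-tuple mR => g (count p y)).
Proof.
move=> mp; pose q (e : 'I_m) (y : m.-tuple mR) := p (tnth y e).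
pose h (b : {ffun 'I_m -> bool}) := g (\sum_(e < m) b e)%N.
have := @measurable_bool_factor _ _ _ q h.
rewrite (_ : (fun x => _) = (fun y : m.-tuple mR => g (count p y))).
  apply=> e; rewrite -[X in measurable X]setTI.
  exact: (@measurable_tnth _ mR m e measurableT _ mp).
apply/funext => y; rewrite /h; congr g; rewrite -sum1_count big_tuple.
by rewrite [RHS]big_mkcond/=; apply: eq_bigr => e _; rewrite ffunE /q; case: (p _).
Qed.

End measurability.

(** * Independent opponents and binomial counts *)

Section independent_opponents.
Variable R : realType.
Local Notation mR := (measurableTypeR R).
Implicit Types (F H : cdf01 R) (P : probability mR R).

Lemma joint_law_cons m (P : 'I_m.+1 -> probability mR R)
    (f : m.+1.-tuple mR -> R) :
  measurable_fun setT f -> (forall y, 0 <= f y) ->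
  (\int[joint_law P]_y (f y)%:E = \int[P ord0]_x
    \int[joint_law (fun i => P (lift ord0 i))]_y (f [tuple of x :: y])%:E)%E.
Proof.
move=> mf f0.
have mEf : measurable_fun setT (EFin \o f) by exact/measurable_EFinP.
rewrite /= (ge0_integral_distribution _ mEf) => [|y]; last by rewrite lee_fin.
have mfc : measurable_fun setT (f \o @cons_draw R m).
  by apply: measurableT_comp => //; exact: measurable_cons_draw.
rewrite (@fubini_tonelli1 _ _ mR _ R (P ord0) _ (EFin \o (f \o @cons_draw R m)))//.
  exact/measurable_EFinP.
by move=> z; rewrite /= lee_fin.
Qed.

Lemma measurable_joint_law_cons m (P : probability (m.-tuple mR) R)
    (f : m.+1.-tuple mR -> R) :
  measurable_fun setT f -> (forall y, 0 <= f y) ->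
  measurable_fun setT (fun x : mR => \int[P]_y (f [tuple of x :: y])%:E)%E.
Proof.
move=> mf f0.
have mfc : measurable_fun setT (f \o @cons_draw R m).
  by apply: measurableT_comp => //; exact: measurable_cons_draw.
have := @measurable_fun_fubini_tonelli_F _ _ mR _ R P (EFin \o (f \o @cons_draw R m)).
apply; first exact/measurable_EFinP.
by move=> z; rewrite /= lee_fin.
Qed.

(** The number of draws satisfying [p] is binomial: induction on m, integrating out the first draw
    by Tonelli. *)
Lemma integral_joint_law_count m P (p : pred R) (g : nat -> R) :
  measurable ([set x | p x] : set mR) -> (forall k, 0 <= g k) ->
  (\int[joint_law (fun _ : 'I_m => P)]_y (g (count p y))%:E =
   (binomial_mean m g (fine (P [set x | ~~ p x])))%:E)%E.
Proof.
move=> mp; elim: m g => [|m IH] g g0.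
  rewrite /= integral_dirac// ?[X in (X * _)%E]diracT ?mul1e//.
  by apply/measurable_EFinP; exact: (@measurable_count R 0 g p mp).
rewrite (@joint_law_cons m (fun=> P) (fun y => g (count p y)))//; last first.
  exact: measurable_count.
set q := fine _.
have mnp : measurable ([set x | ~~ p x] : set mR).
  rewrite [X in measurable X](_ : _ = ~` [set x | p x]); first exact: measurableC.
  by apply/seteqP; split => x /= /negP.
have q01 : 0 <= q <= 1.
  by rewrite /q -!lee_fin fineK ?fin_num_measure// measure_ge0 probability_le1.
(* The mean over the other m draws, when the first one contributes i to the count. *)
pose b i := binomial_mean m (fun k => g (i + k)%N) q.
have b0 i : 0 <= b i by exact: binomial_mean_ge0.
transitivity (\int[P]_x (b (p x))%:E)%E.
  by apply: eq_integral => x _; exact: (IH (fun k => g (p x + k)%N)).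
transitivity (\int[P]_x ((b 0%N)%:E * (\1_[set x | ~~ p x] x)%:E +
    (b 1%N)%:E * (\1_[set x | p x] x)%:E))%E.
  apply: eq_integral => x _; rewrite !indicE.
  case: (boolP (p x)) => px.
    by rewrite memNset/= ?px// mem_set//= mule0 mule1 add0e.
  by rewrite mem_set//= memNset/= ?(negbTE px)// mule0 mule1 adde0.
have mi (A : set mR) : measurable A -> measurable_fun setT (fun x => (\1_A x : R)%:E).
  by move=> mA; exact/measurable_EFinP/measurable_indic.
have mA := mi _ mnp; have mB := mi _ mp.
have iA (A : set mR) (c : R) : 0 <= c -> measurable A ->
    (\int[P]_x (c%:E * (\1_A x)%:E) = c%:E * \int[P]_x (\1_A x)%:E)%E.
  by move=> c0 mA'; apply: ge0_integralZl => //; exact: mi.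
transitivity ((b 0%N)%:E * \int[P]_x (\1_[set x | ~~ p x] x)%:E +
    (b 1%N)%:E * \int[P]_x (\1_[set x | p x] x)%:E)%E.
  rewrite -!iA//; apply: ge0_integralD => //.
  - by move=> x _; rewrite mule_ge0// lee_fin.
  - exact: measurable_funeM.
  - by move=> x _; rewrite mule_ge0// lee_fin.
  - exact: measurable_funeM.
rewrite !integral_indic// !setIT.
have Pq : P [set x | ~~ p x] = q%:E by rewrite /q fineK// fin_num_measure.
have Pq' : P [set x | p x] = (1 - q)%:E.
  have := probability_setC P mnp; rewrite Pq.
  rewrite (_ : ~` _ = [set x | p x]) => [->//|].
  by apply/seteqP; split => x /=; [move=> /negP; rewrite negbK|move=> px /negP].
rewrite [X in (_ * X + _)%E]Pq [X in (_ + _ * X)%E]Pq' -!EFinM -EFinD.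
by rewrite mulrC [X in _ + X]mulrC.
Qed.

End independent_opponents.

Section prize_vectors.
Variables (R : realType) (n : nat) (v : n.-tuple R).
Hypothesis pv : prize_vector v.

(** The last prize is 0, and so is the default value of [nth] beyond it; prizes thus form a
    nonincreasing sequence indexed by all of nat. *)
Lemma prize_out k : (n.-1 <= k)%N -> v`_k = 0.
Proof.
have [_ v0 _] := pv; rewrite leq_eqVlt => /predU1P[<-//|nk].
by rewrite nth_default// size_tuple; case: n nk.
Qed.

Lemma prize_homo : {homo nth 0 v : i j / (i <= j)%N >-> j <= i}.
Proof.
have [sv v0 _] := pv; move=> i j ij.
have ge_trans : transitive (>=%R : rel R) by move=> a b c /[swap]; exact: le_trans.
have homo k l : (k <= l)%N -> (l < n)%N -> v`_l <= v`_k.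
  move=> kl ln; apply: (sorted_leq_nth ge_trans (@lexx _ R) 0 sv) => //;
  by rewrite inE size_tuple// (leq_ltn_trans kl).
have [jn|nj] := ltnP j n; first exact: homo.
have [ni|iN] := leqP n.-1 i; first by rewrite !prize_out// (leq_trans ni).
rewrite (@prize_out j); last by rewrite (leq_trans (leq_pred n)).
rewrite -[leLHS]v0; apply: homo; first exact: ltnW.
by case: n iN.
Qed.

Lemma prize_itv k : 0 <= v`_k <= 1.
Proof.
have [_ _ v1] := pv; apply/andP; split.
  (* The index [maxn n.-1 k] is at least k and carries the prize 0. *)
  by rewrite -[leLHS](prize_out (leq_maxl n.-1 k)); exact/prize_homo/leq_maxr.
have ge0 j : 0 <= v`_j.
  by rewrite -[leLHS](prize_out (leq_maxl n.-1 j)); exact/prize_homo/leq_maxr.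
have [kn|nk] := ltnP k n.
  rewrite -v1 (bigD1 (Ordinal kn))//= lerDl sumr_ge0// => j _; exact: ge0.
by rewrite prize_out ?ler01// (leq_trans (leq_pred n)).
Qed.

End prize_vectors.

Lemma count_tnth (T : Type) m (p : pred T) (y : m.-tuple T) :
  count p y = (\sum_(j < m) p (tnth y j))%N.
Proof.
rewrite -sum1_count big_tuple big_mkcond/=.
by apply: eq_bigr => j _; case: (p _).
Qed.

Lemma card_ordS m (q : pred 'I_m.+1) :
  #|[pred j | q j]| = (q ord0 + \sum_(j < m) q (lift ord0 j))%N.
Proof.
by rewrite -sum1_card big_mkcond big_ord_recl.
Qed.

(** * Expected prize of a performance against draws from F *)

Section expected_prize.
Variables (R : realType) (N : nat) (v : N.+1.-tuple R).
Hypothesis pv : prize_vector v.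
Local Notation mR := (measurableTypeR R).
Implicit Types (F H : cdf01 R).

Definition expected_prize F (x : R) : R :=
  \int[joint_law (fun _ : 'I_N => dcdf F)]_y gross_payoff v ord0 [tuple of x :: y].

Lemma gross_payoff_itv (x : N.+1.-tuple mR) i : 0 <= gross_payoff v i x <= 1.
Proof.
by rewrite gross_payoff_ge ?gross_payoff_le// => s _;
  case/andP: (prize_itv pv (s i)).
Qed.

Lemma measurable_gross_payoff_cons (x : mR) :
  measurable_fun setT
    (fun y : N.-tuple mR => gross_payoff v ord0 [tuple of x :: y]).
Proof.
apply: measurableT_comp; first exact: measurable_gross_payoff.
by apply: measurable_cons => //; exact: measurable_cst.
Qed.

Lemma expected_prizeE F (x : R) :
  ((expected_prize F x)%:E = \int[joint_law (fun _ : 'I_N => dcdf F)]_y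
    (gross_payoff v ord0 [tuple of x :: y])%:E)%E.
Proof.
rewrite /expected_prize /Rintegral fineK//.
apply: integrable_fin_num => //.
apply: (@bounded_integrable R _ _ _ _ 0 1 (measurable_gross_payoff_cons x)) => y.
exact: gross_payoff_itv.
Qed.

Lemma expected_prize_itv F (x : R) : 0 <= expected_prize F x <= 1.
Proof.
rewrite -!lee_fin expected_prizeE integral_ge0/=; last first.
  by move=> y _; rewrite lee_fin; case/andP: (gross_payoff_itv [tuple of x :: y] ord0).
set P := joint_law _.
rewrite (_ : 1%:E = \int[P]_y (1%:E))%E; last first.
  by rewrite integral_cst// [X in (_ * X)%E]probability_setT mule1.
apply: ge0_le_integral => //.
- by move=> y _; rewrite lee_fin; case/andP: (gross_payoff_itv [tuple of x :: y] ord0).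
- by apply/measurable_EFinP; exact: measurable_gross_payoff_cons.
- by move=> y _; rewrite lee_fin; case/andP: (gross_payoff_itv [tuple of x :: y] ord0).
Qed.

Lemma measurable_expected_prize F : measurable_fun setT (expected_prize F : mR -> R).
Proof.
apply/measurable_EFinP.
have g0 y : 0 <= gross_payoff v ord0 y by case/andP: (gross_payoff_itv y ord0).
have := measurable_joint_law_cons (joint_law (fun _ : 'I_N => dcdf F))
  (measurable_gross_payoff v ord0) g0.
by apply: eq_measurable_fun => x _ /=; rewrite expected_prizeE.
Qed.

Lemma net_payoffE (C : cdf01 R -> R) F H :
  net_payoff v C ord0 (fun j => if j == ord0 then H else F) =
  fine (\int[dcdf H]_x (expected_prize F x)%:E)%E - C H.
Proof.
have g0 y : 0 <= gross_payoff v ord0 y by case/andP: (gross_payoff_itv y ord0).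
rewrite /net_payoff eqxx; congr (fine _ - _).
rewrite (@joint_law_cons R N _ _ (measurable_gross_payoff v ord0) g0) eqxx.
by apply: eq_integral => x _; rewrite expected_prizeE.
Qed.

Lemma le_expected_prize F (x : R) (p : pred R) (g : nat -> R) :
  measurable ([set z | p z] : set mR) -> (forall k, 0 <= g k) ->
  (forall y : N.-tuple mR,
    g (count p y) <= gross_payoff v ord0 [tuple of x :: y]) ->
  binomial_mean N g (fine (dcdf F [set z | ~~ p z])) <= expected_prize F x.
Proof.
move=> mp g0 gp; rewrite -lee_fin expected_prizeE -integral_joint_law_count//.
apply: ge0_le_integral => //.
- by move=> y _; rewrite lee_fin.
- by apply/measurable_EFinP; exact: measurable_count.
- by apply/measurable_EFinP; exact: measurable_gross_payoff_cons.
- by move=> y _; rewrite lee_fin.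
Qed.

(** Worst case: every tied opponent is ranked ahead, so the rank is at most the number of opponents
    z with x <= z. *)
Lemma expected_prize_ge F (x : R) :
  binomial_mean N (nth 0 v) (fine (dcdf F `]-oo, x[%classic)) <=
  expected_prize F x.
Proof.
have := @le_expected_prize F x (fun z => x <= z) (nth 0 v).
rewrite [X in dcdf F X](_ : _ = `]-oo, x[%classic); last first.
  by apply/seteqP; split => z /=; rewrite in_itv/= -ltNge.
apply; first by rewrite [X in measurable X](_ : _ = `[x, +oo[%classic)//;
  apply/seteqP; split => z /=; rewrite in_itv/= andbT.
- by move=> k; case/andP: (prize_itv pv k).
- move=> y; apply: gross_payoff_ge => s /compatible_ranking_le-/(_ ord0).
  rewrite card_ordS eqxx/= add0n => sle; apply: (prize_homo pv).
  rewrite (leq_trans sle)// count_tnth; apply/eq_leq/eq_bigr => j _.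
  by rewrite tnthS.
Qed.

(** Best case: every tie is won, so the rank is the number of strictly better opponents. On the
    event that all opponents tie at x, of probability dF({x})^N, this overstates the payoff by at
    least [tie_loss v]. *)
Lemma expected_prize_le F (x : R) : (0 < N)%N ->
  expected_prize F x + tie_loss v * fine (dcdf F [set x]) ^+ N <=
  binomial_mean N (nth 0 v) (F x).
Proof.
move=> N0; have v01 := prize_itv pv; have nv := prize_homo pv.
have tl0 : 0 <= tie_loss v by rewrite divr_ge0// subr_ge0 nv.
pose p z := x < z; pose p' z := z != x.
have mp : measurable ([set z | p z] : set mR).
  by rewrite [X in measurable X](_ : _ = `]x, +oo[%classic)//;
    apply/seteqP; split => z /=; rewrite in_itv/= andbT.
have mp' : measurable ([set z | p' z] : set mR).
  rewrite [X in measurable X](_ : _ = ~` [set x]); first exact: measurableC.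
  by apply/seteqP; split => z /= /eqP.
have -> : F x = fine (dcdf F [set z | ~~ p z]).
  rewrite (_ : [set z | ~~ p z] = `]-oo, x]%classic) ?dcdf_Nyc//.
  by apply/seteqP; split => z /=; rewrite in_itv/= /p -leNgt.
(* The binomial mean of the indicator of 0 is q^N: it is the probability that no opponent differs
   from x. *)
pose e k : R := (k == 0%N)%:R.
have -> : fine (dcdf F [set x]) ^+ N =
    binomial_mean N e (fine (dcdf F [set z | ~~ p' z])).
  rewrite (_ : [set z | ~~ p' z] = [set x]); last first.
    by apply/seteqP; split => z /=; rewrite /p' negbK => /eqP.
  elim: (N) => [|m IH]/=; first by rewrite expr0 /e eqxx.
  rewrite -IH exprS [e \o succn](_ : _ = fun=> 0) ?binomial_mean_cst ?mulr0 ?addr0//.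
have v0 k : 0 <= v`_k by case/andP: (v01 k).
have g0 y : 0 <= gross_payoff v ord0 y by case/andP: (gross_payoff_itv y ord0).
rewrite -lee_fin EFinD EFinM expected_prizeE -!integral_joint_law_count//.
have mc := measurable_count e mp'.
rewrite -ge0_integralZl//; last 2 first.
  by apply/measurable_EFinP; exact: mc.
  by move=> y _; rewrite lee_fin.
rewrite -ge0_integralD//; last 4 first.
- by move=> y _; rewrite lee_fin.
- by apply/measurable_EFinP; exact: measurable_gross_payoff_cons.
- by move=> y _; rewrite mule_ge0// lee_fin.
- by apply: measurable_funeM; by apply/measurable_EFinP; exact: mc.
apply: ge0_le_integral => //.
- by move=> y _; rewrite adde_ge0 ?mule_ge0// lee_fin.
- apply: emeasurable_funD.
    by apply/measurable_EFinP; exact: measurable_gross_payoff_cons.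
  by apply: measurable_funeM; by apply/measurable_EFinP; exact: mc.
- by apply/measurable_EFinP; exact: measurable_count.
move=> y _; rewrite -EFinM -EFinD lee_fin /e.
have rank s : compatible_ranking [tuple of x :: y] s -> (count p y <= s ord0)%N.
  move=> /compatible_ranking_ge-/(_ ord0); rewrite card_ordS ltxx add0n.
  apply: leq_trans; rewrite count_tnth; apply/eq_leq/eq_bigr => j _.
  by rewrite tnthS.
(* If some opponent differs from x, the rank bound suffices; otherwise everybody ties and nobody is
   strictly better. *)
have [c0|cN] := eqVneq (count p' y) 0%N; last first.
  by rewrite mulr0 addr0; apply: gross_payoff_le => s /rank; exact: nv.
rewrite mulr1 -lerBrDr.
have yx j : tnth y j = x.
  have /hasPn/(_ (tnth y j)) : ~~ has p' y by rewrite has_count c0.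
  by rewrite mem_tnth /p' negbK => /(_ isT)/eqP.
have -> : count p y = 0%N.
  by rewrite count_tnth big1// => j _; rewrite yx /p ltxx.
apply: gross_payoff_tie => // j.
by case: (unliftP ord0 j) => [k|] ->; rewrite ?tnthS ?yx.
Qed.

End expected_prize.

(** * Equilibrium *)

Section first_order_condition.
Variable R : realType.

(** The points z + (y - z) / (k + 1) approach z inside A without reaching it if y differs from z.
    This turns the relative derivative, possibly one-sided, into the limit of a sequence. *)
Lemma derive_in_cvg (A : set R) (f : R -> R) (z y : R) :
  derivable_in A f z -> (forall t : R, 0 < t <= 1 -> A (z + t * (y - z))) ->
  (f (z + k.+1%:R^-1 * (y - z)) - f z) / k.+1%:R^-1 @[k --> \oo] -->
  derive_in A f z * (y - z).
Proof.
move=> df Az.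
have [->|yz] := eqVneq y z.
  apply: cvg_near_cst; near=> k.
  by rewrite subrr !mulr0 addr0 subrr mul0r.
pose s k := z + k.+1%:R^-1 * (y - z).
have sz : s k @[k --> \oo] --> z.
  rewrite -[X in _ --> X]addr0; apply: cvgD; first exact: cvg_cst.
  rewrite -[X in _ --> X](mul0r (y - z)); apply: cvgM; last exact: cvg_cst.
  exact: cvg_harmonic.
have sA : s @ \oo --> within A z^'.
  move=> U HU.
  have Uz : \forall x \near z, x != z -> A x -> U x by [].
  change (\forall k \near \oo, U (s k)).
  have Us : \forall k \near \oo, s k != z -> A (s k) -> U (s k) := sz _ Uz.
  apply: filterS Us => k; apply.
  - rewrite /s -subr_eq0 addrAC subrr add0r.
    by rewrite mulf_neq0 ?invr_eq0 ?pnatr_eq0// subr_eq0.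
  - by apply: Az; rewrite invr_gt0 ltr0n invf_le1 ?ltr0n// ler1n.
have := cvg_comp _ _ sA df.
rewrite -/(derive_in A f z) => H.
apply: cvg_trans (cvgM H (cvg_cst (y - z))).
apply: near_eq_cvg; near=> k.
rewrite /= /diff_quotient /s addrAC subrr add0r.
by field; rewrite nat1r pnatr_eq0 subr_eq0.
Unshelve. all: by end_near. Qed.

Lemma derive_in_ge (A : set R) (f : R -> R) (z y c : R) :
  derivable_in A f z -> (forall t : R, 0 < t <= 1 -> A (z + t * (y - z))) ->
  (forall t : R, 0 < t <= 1 -> t * c <= f (z + t * (y - z)) - f z) ->
  c <= derive_in A f z * (y - z).
Proof.
move=> df Az cf; have H := derive_in_cvg df Az.
rewrite -(cvg_lim _ H)//; apply: limr_ge; first by apply: cvgP; exact: H.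
near=> k; rewrite ler_pdivlMr ?invr_gt0 ?ltr0n// mulrC cf//.
by rewrite invr_gt0 ltr0n invf_le1 ?ltr0n// ler1n.
Unshelve. all: by end_near. Qed.

Lemma derive_in_le (A : set R) (f : R -> R) (z y c : R) :
  derivable_in A f z -> (forall t : R, 0 < t <= 1 -> A (z + t * (y - z))) ->
  (forall t : R, 0 < t <= 1 -> f (z + t * (y - z)) - f z <= t * c) ->
  derive_in A f z * (y - z) <= c.
Proof.
move=> df Az cf; have H := derive_in_cvg df Az.
rewrite -(cvg_lim _ H)//; apply: limr_le; first by apply: cvgP; exact: H.
near=> k; rewrite ler_pdivrMr ?invr_gt0 ?ltr0n// [leRHS]mulrC cf//.
by rewrite invr_gt0 ltr0n invf_le1 ?ltr0n// ler1n.
Unshelve. all: by end_near. Qed.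

(** Both derivatives are compared with the slope of the chord from 0 to z. *)
Lemma convex_derive_in_ge0 (b z : R) (f : R -> R) : 0 <= z <= b ->
  convex_on `[0, b]%classic f -> (forall x, `[0, b]%classic x ->
    derivable_in `[0, b] f x) ->
  derive_in `[0, b] f 0 <= derive_in `[0, b] f z.
Proof.
move=> /andP[z0 zb] cf df.
have [<-//|zn0] := eqVneq 0 z.
have z0' : 0 < z by rewrite lt_neqAle zn0.
have Az (x : R) : 0 <= x <= z -> `[0, b]%classic x.
  by case/andP => x0 xz; rewrite /= in_itv/= x0 (le_trans xz).
have A0 := Az 0; have AZ := Az z; rewrite lexx z0 in A0; rewrite lexx z0 in AZ.
have H0 : derive_in `[0, b] f 0 * (z - 0) <= f z - f 0.
  apply: derive_in_le; [exact/df/A0| |] => t /andP[t0 t1].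
    by apply: Az; apply/andP; split; nra.
  have := cf t z 0 (AZ isT) (A0 isT); rewrite (ltW t0) t1 => /(_ isT).
  rewrite (_ : t * z + (1 - t) * 0 = 0 + t * (z - 0)); last by ring.
  lra.
have HZ : derive_in `[0, b] f z * (0 - z) <= f 0 - f z.
  apply: derive_in_le; [exact/df/AZ| |] => t /andP[t0 t1].
    by apply: Az; apply/andP; split; nra.
  have := cf t 0 z (A0 isT) (AZ isT); rewrite (ltW t0) t1 => /(_ isT).
  rewrite (_ : t * 0 + (1 - t) * z = z + t * (0 - z)); last by ring.
  lra.
by rewrite -(ler_pM2r z0'); lra.
Qed.

End first_order_condition.

Section dcdf_almost_everywhere.
Variable R : realType.
Local Notation mR := (measurableTypeR R).
Implicit Types F : cdf01 R.

Lemma ae_dcdf01 F : {ae dcdf F, forall x : mR, 0 <= (x : R) <= 1}.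
Proof.
exists (~` `[0, 1]%classic); split; [exact: measurableC|exact: dcdf_setC01|].
by move=> x /= x01; rewrite in_itv.
Qed.

Lemma eq_Rintegral_dcdf01 F (f g : mR -> R) :
  measurable_fun setT f -> measurable_fun setT g ->
  {ae dcdf F, forall x : mR, f x = g x} ->
  \int[dcdf F]_x f x = \int[dcdf F]_x g x.
Proof.
move=> mf mg fg; congr fine; apply: ae_eq_integral => //.
- exact/measurable_EFinP.
- exact/measurable_EFinP.
- by apply: filterS fg => x -> _.
Qed.

Lemma ae_eq0_Rintegral F (f : mR -> R) : bounded_measurable f ->
  (forall x, 0 <= f x) -> \int[dcdf F]_x f x = 0 ->
  {ae dcdf F, forall x : mR, f x = 0}.
Proof.
move=> bf f0 intf; have mf := bf.1.
have intf0 : (\int[dcdf F]_x (f x)%:E = 0)%E.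
  rewrite -[LHS]fineK; first by congr EFin; exact: intf.
  exact: integrable_fin_num (bounded_measurable_integrable (dcdf F) bf).
have [] := ae_eq_integral_abs (dcdf F) measurableT (f := EFin \o f) _.
  exact/measurable_EFinP.
move=> + _; rewrite (eq_integral (fun x => (f x)%:E)); last first.
  by move=> x _ /=; rewrite ger0_norm.
by move=> /(_ intf0); apply: filterS => x /(_ I) [].
Qed.

(** An exceptional null set containing a would make {a} null. *)
Lemma ae_atom F (a : R) (Q : R -> Prop) : dcdf F [set a] <> 0%E ->
  {ae dcdf F, forall x : mR, Q x} -> Q a.
Proof.
move=> Fa [B [mB B0 QB]]; apply: contrapT => nQ; apply: Fa.
apply/eqP; rewrite eq_le measure_ge0 andbT -B0 le_measure ?inE//.
by move=> x ->; exact: QB.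
Qed.

Lemma Rintegral_transform F (f : mR -> R) :
  (forall x, dcdf F [set x] = 0%E) -> bounded_measurable f ->
  \int[dcdf F]_x f (F x) = \int[@uniform01 R]_x f x.
Proof.
move=> Fx bf; congr fine.
have bfF : bounded_measurable (f \o F).
  split; first by apply: measurableT_comp bf.1 _; exact: measurable_cdf01.
  by have [_ [M fM]] := bf; exists M => x; exact: fM.
transitivity (\int[distribution (dcdf F) (F : mR -> mR)]_x (f x)%:E)%E.
  have mE : measurable_fun setT (EFin \o f) by apply/measurable_EFinP; exact: bf.1.
  rewrite (integral_distribution mE)//.
  exact: (bounded_measurable_integrable (dcdf F) bfF).
by apply: eq_measure_integral => A mA _; exact: probability_integral_transform.
Qed.

End dcdf_almost_everywhere.

(** * Structure of a symmetric equilibrium *)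

Section equilibrium.
Variables (R : realType) (N : nat) (C : cdf01 R -> R) (gam Ups : R -> R).
Local Notation mR := (measurableTypeR R).
Hypothesis N_gt0 : (0 < N)%N.
Hypothesis C_def : forall F : cdf01 R,
  C F = Ups (\int[dcdf F]_(x in `[0, 1]) gam x).
Hypothesis gam_ge0 : forall x, x \in `[0, 1] -> 0 <= gam x.
Hypothesis gam_cont : {within `[0, 1], continuous gam}.
Hypothesis gam_incr : {in `[0, 1] &, {homo gam : x y / x < y}}.
Hypothesis gam_0 : gam 0 = 0.
Hypothesis Ups_convex : convex_on `[0, gam 1]%classic Ups.
Hypothesis Ups_deriv : forall z, `[0, gam 1]%classic z ->
  derivable_in `[0, gam 1] Ups z.
Hypothesis Ups_0 : 1 < derive_in `[0, gam 1] Ups 0 * gam 1.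

Variables (v : N.+1.-tuple R) (F : cdf01 R).
Hypothesis v_prize : prize_vector v.
Hypothesis v_top : v`_1 < v`_0.
Hypothesis F_eq : symmetric_equilibrium v C F.

Local Notation gamc := (gam \o clamp01 (R := R)).
Local Notation e := (expected_prize v F).

Definition mean_gam (H : cdf01 R) : R := \int[dcdf H]_x gamc x.

Lemma gam_homo : {in `[0, 1] &, {homo gam : x y / x <= y}}.
Proof.
move=> x y x01 y01; rewrite le_eqVlt => /predU1P[->//|xy].
exact/ltW/gam_incr.
Qed.

Lemma bounded_measurable_gamc : bounded_measurable gamc.
Proof. exact/bounded_measurable_homo/gam_homo. Qed.

Lemma gamc_itv x : 0 <= gamc x <= gam 1.
Proof. by have := clamp01_bounds gam_homo x; rewrite gam_0. Qed.

Lemma integrable_gamc (H : cdf01 R) :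
  (dcdf H).-integrable setT (EFin \o gamc).
Proof. exact: bounded_measurable_integrable bounded_measurable_gamc. Qed.

Lemma mean_gam_itv (H : cdf01 R) : 0 <= mean_gam H <= gam 1.
Proof.
have [g0 g1] := (fun x => andP (gamc_itv x), tt).
rewrite /mean_gam Rintegral_ge0/=; last by move=> x _; case: (g0 x).
have <- : \int[dcdf H]_x (gam 1) = gam 1.
  by rewrite Rintegral_cst// [X in fine X]probability_setT mulr1.
apply: le_Rintegral => //; first exact: integrable_gamc.
  exact: bounded_measurable_integrable (bounded_measurable_cst _).
by move=> x _; case: (g0 x).
Qed.

Lemma costE (H : cdf01 R) : C H = Ups (mean_gam H).
Proof. by rewrite C_def /mean_gam /Rintegral integral_clamp01//; exact: gam_homo. Qed.

Lemma bounded_measurable_expected_prize : bounded_measurable e.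
Proof.
split; first exact: measurable_expected_prize.
exists 1 => x; have /andP[e0 e1] := expected_prize_itv v_prize F x.
by rewrite ger0_norm.
Qed.

Definition mean_prize : R := \int[dcdf F]_x e x.

(** The deviation to (1 - t) F + t delta_x is not profitable; the expected prize and the argument of
    [Ups] are both affine in t. *)
Lemma equilibrium_mixture (x t : R) : 0 <= x <= 1 -> 0 <= t <= 1 ->
  t * (e x - mean_prize) <=
  Ups (mean_gam F + t * (gam x - mean_gam F)) - Ups (mean_gam F).
Proof.
move=> x01 t01; have [H HE] := mixture_cdf01 F t01 x01.
have e0 y : (0 <= (e y)%:E)%E.
  by rewrite lee_fin; case/andP: (expected_prize_itv v_prize F y).
have g0 y : (0 <= (gamc y)%:E)%E by rewrite lee_fin; case/andP: (gamc_itv y).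
have mE : measurable_fun setT (fun y : mR => (e y)%:E).
  by apply/measurable_EFinP; exact: measurable_expected_prize.
have mg : measurable_fun setT (fun y : mR => (gamc y)%:E).
  by apply/measurable_EFinP; exact: bounded_measurable_gamc.1.
have ie := bounded_measurable_integrable (dcdf F) bounded_measurable_expected_prize.
have He : fine (\int[dcdf H]_y (e y)%:E)%E = (1 - t) * mean_prize + t * e x.
  rewrite HE// -[(\int[dcdf F]_y (e y)%:E)%E]fineK//.
  exact: (integrable_fin_num measurableT ie).
have Hg : mean_gam H = (1 - t) * mean_gam F + t * gam x.
  rewrite {1}/mean_gam /Rintegral HE// -[(\int[dcdf F]_y (gamc y)%:E)%E]fineK//=.
    by rewrite clamp01_id.
  exact: (integrable_fin_num measurableT (integrable_gamc F)).
have := F_eq (i := ord0) erefl H.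
rewrite (net_payoffE v_prize) He costE Hg.
have -> : net_payoff v C ord0 (fun=> F) = mean_prize - Ups (mean_gam F).
  have := net_payoffE v_prize C F F.
  rewrite (_ : (fun j => _) = (fun=> F)); last by apply/funext => j; case: eqP.
  by rewrite costE.
rewrite (_ : mean_gam F + t * (gam x - mean_gam F) =
  (1 - t) * mean_gam F + t * gam x); last by ring.
lra.
Qed.

Local Notation z := (mean_gam F).
Definition marginal_cost : R := derive_in `[0, gam 1] Ups z.
Local Notation lam := marginal_cost.
(** The mean of e - lam gam under dF. *)
Definition surplus : R := mean_prize - lam * z.
Local Notation c := surplus.

(** The mixture inequality is divided by t, and t tends to 0. *)
Lemma expected_prize_le_cost (x : R) : 0 <= x <= 1 -> e x <= c + lam * gam x.
Proof.
move=> x01; have x01' : x \in `[0, 1] by rewrite in_itv.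
have /andP[z0 z1] := mean_gam_itv F.
have gx0 := gam_ge0 x01'.
have gx1 : gam x <= gam 1.
  by apply: gam_homo => //; rewrite ?in_itv/= ?ler01 ?lexx//; case/andP: x01.
suff : e x - mean_prize <= lam * (gam x - z) by rewrite /surplus; lra.
apply: derive_in_ge; first by apply: Ups_deriv; rewrite /= in_itv/= z0.
  by move=> t /andP[t0 t1]; rewrite /= in_itv/=; apply/andP; split; nra.
by move=> t /andP[t0 t1]; apply: equilibrium_mixture; rewrite ?(ltW t0).
Qed.

(** Convexity carries the bound on the derivative at 0 over to the derivative at z. *)
Lemma marginal_cost_gt1 : 1 < lam * gam 1.
Proof.
apply: (lt_le_trans Ups_0); apply: ler_wpM2r.
  by apply: gam_ge0; rewrite in_itv/= ler01 lexx.
exact: convex_derive_in_ge0 (mean_gam_itv F) Ups_convex Ups_deriv.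
Qed.

(** A zero performance costs nothing and earns a nonnegative prize. *)
Lemma surplus_ge0 : 0 <= c.
Proof.
have := @expected_prize_le_cost 0; rewrite lexx ler01 gam_0 mulr0 addr0.
move=> /(_ isT); apply: le_trans.
by case/andP: (expected_prize_itv v_prize F 0).
Qed.

(** The function c + lam gam - e is nonnegative on [0, 1] and has mean 0 by the choice of c. *)
Lemma expected_prize_ae : {ae dcdf F, forall x : mR, e x = c + lam * gamc x}.
Proof.
(* Clamping [e] as well makes the inequality hold on the whole line. *)
pose ec : mR -> R := e \o clamp01 (R := R).
have mclamp : measurable_fun setT (clamp01 (R := R) : mR -> mR).
  exact: (@measurable_clamp01 R id).
have be := bounded_measurable_expected_prize.
have bec : bounded_measurable ec.
  split; first by apply: measurableT_comp be.1 mclamp.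
  by have [_ [M eM]] := be; exists M => x; exact: eM.
have e_ec : {ae dcdf F, forall x : mR, e x = ec x}.
  by apply: filterS (ae_dcdf01 F) => x x01; rewrite /ec/= clamp01_id.
have bg := bounded_measurableM (bounded_measurable_cst lam) bounded_measurable_gamc.
have bcg := bounded_measurableD (bounded_measurable_cst c) bg.
have bh := bounded_measurableB bcg bec.
have intC (k : R) : \int[dcdf F]_x k = k.
  by rewrite Rintegral_cst// [X in fine X]probability_setT mulr1.
have : {ae dcdf F, forall x : mR, c + lam * gamc x - ec x = 0}.
  apply: (ae_eq0_Rintegral bh) => [x|].
    by rewrite subr_ge0 expected_prize_le_cost ?clamp01_itv.
  have I := fun f bf => @bounded_measurable_integrable R (dcdf F) f bf.
  rewrite RintegralB//; [|exact: I bcg|exact: I bec].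
  rewrite RintegralD//; [|exact: I (bounded_measurable_cst c)|exact: I bg].
  rewrite RintegralZl//; last exact: I bounded_measurable_gamc.
  rewrite -(eq_Rintegral_dcdf01 be.1 bec.1 e_ec) intC.
  by rewrite /surplus -/mean_prize -/(mean_gam F); ring.
apply: filterS2 e_ec => x -> /eqP.
by rewrite subr_eq0 => /eqP ->.
Qed.

Lemma equilibrium_atomless (a : R) : dcdf F [set a] = 0%E.
Proof.
apply: contrapT => Fa.
have a01 := ae_atom Fa (ae_dcdf01 F).
have := ae_atom Fa expected_prize_ae; rewrite /= clamp01_id// => ea.
have /andP[a0 a1] := a01.
(* An atom at 1 would force e(1) = c + lam gam(1) > 1, more than any prize. *)
have [aE|an1] := eqVneq a 1.
  have /andP[_] := expected_prize_itv v_prize F a.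
  by have := marginal_cost_gt1; have := surplus_ge0; rewrite ea aE; lra.
have {an1}a1 : a < 1 by rewrite lt_neqAle an1.
have gam_a : gam y @[y --> a^'+] --> gam a.
  have /(continuous_within_itvP _ (@ltr01 R))[g g0 _] := gam_cont.
  have [->//|a_neq0] := eqVneq a 0.
  apply: cvg_at_right_filter; apply: g.
  by rewrite in_itv/= a1 lt_neqAle eq_sym a_neq0 a0.
have Fa0 : 0 < fine (dcdf F [set a]).
  rewrite lt_neqAle fine_ge0 ?measure_ge0// andbT; apply/eqP => Fa'.
  by apply: Fa; rewrite -[LHS]fineK ?fin_num_measure// -Fa'.
have loss0 : 0 < tie_loss v.
  rewrite divr_gt0 ?subr_gt0// ltr0n; apply/card_gt0P; exists 1%g.
  by [].
(* Ties at the atom make e(a) strictly less than P_v(F(a)), but every y > a earns at least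
   P_v(F(a)); letting y tend to a contradicts the bound c + lam gam(y) on e(y). *)
have lt_a : e a < binomial_mean N (nth 0 v) (F a).
  apply: lt_le_trans (expected_prize_le v_prize F a N_gt0).
  by rewrite ltrDl mulr_gt0// exprn_gt0.
have : binomial_mean N (nth 0 v) (F a) <= c + lam * gam a.
  have cv : (c + lam * gam y) @[y --> a^'+] --> c + lam * gam a.
    by apply: cvgD; [exact: cvg_cst|apply: cvgM gam_a; exact: cvg_cst].
  rewrite -(cvg_lim _ cv)//; apply: limr_ge; first by apply: cvgP; exact: cv.
  near=> y.
  have ay : a < y by near: y; exact: nbhs_right_gt.
  have y1 : y < 1 by near: y; exact: nbhs_right_lt.
  have y01 : 0 <= y <= 1 by rewrite (ltW y1) andbT ltW// (le_lt_trans a0).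
  apply: le_trans (expected_prize_le_cost y01).
  apply: le_trans (expected_prize_ge v_prize F y).
  have Fy : F a <= fine (dcdf F `]-oo, y[%classic).
    rewrite -lee_fin fineK ?fin_num_measure// -dcdf_Nyc.
    apply: le_measure; rewrite ?inE// => x /=; rewrite !in_itv/= => xa.
    exact: le_lt_trans ay.
  apply: (binomial_mean_homo N (prize_homo v_prize)) => //.
    by rewrite in_itv/= cdf01_ge0 cdf01_le1.
  rewrite in_itv/= -!lee_fin fineK ?fin_num_measure//.
  by rewrite measure_ge0 probability_le1.
by rewrite -ea leNgt lt_a.
Unshelve. all: by end_near. Qed.

(** Without atoms, the worst and the best treatment of ties give the same bound. *)
Lemma expected_prize_cdf (x : R) : e x = binomial_mean N (nth 0 v) (F x).
Proof.
apply/eqP; rewrite eq_le; apply/andP; split.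
  apply: le_trans (expected_prize_le v_prize F x N_gt0).
  rewrite lerDl mulr_ge0//; last by rewrite exprn_ge0// fine_ge0// measure_ge0.
  by rewrite divr_ge0// subr_ge0 ltW.
have := expected_prize_ge v_prize F x.
by rewrite dcdf_Nyo//; exact: equilibrium_atomless.
Qed.

Lemma marginal_cost_gt0 : 0 < lam.
Proof.
have := marginal_cost_gt1; have := gam_ge0 (x := 1); rewrite in_itv/= ler01 lexx.
by move=> /(_ isT) g1; rewrite ltNge => lt1; apply/negP => l0; nra.
Qed.

(** Since P_v(0) is the last prize 0, a positive c would exceed P_v(F(x)) whenever F(x) <= eps / 2,
    an event of positive probability as F(X) is uniform. But e >= c almost everywhere. *)
Lemma surplus_eq0 : c = 0.
Proof.
apply/eqP; rewrite eq_le surplus_ge0 andbT leNgt; apply/negP => c0.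
have b0 : binomial_mean N (nth 0 v) 0 = 0.
  by rewrite binomial_mean_0; have [_ + _] := v_prize.
have : \forall t \near (0 : R), binomial_mean N (nth 0 v) t < c.
  apply: cvgr_lt (@continuous_binomial_mean R N (nth 0 v) 0) _ _.
  by rewrite b0.
move=> /nbhs_ballP[eps /= eps0 epsP].
have [B [mB B0 eB]] := expected_prize_ae.
pose A : set mR := `]-oo, eps / 2]%classic.
have mA : measurable A by exact: measurable_itv.
have : dcdf F ((F : mR -> mR) @^-1` A) = (clamp01 (eps / 2))%:E.
  rewrite -uniform01_Nyc -(probability_integral_transform equilibrium_atomless)//.
suff -> : dcdf F ((F : mR -> mR) @^-1` A) = 0%E.
  move=> [] /esym; rewrite /clamp01; case: (leP 1 (eps / 2)) => _;
  case: (leP 0 _) => ?; lra.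
apply/eqP; rewrite eq_le measure_ge0 andbT -B0 le_measure ?inE//.
  by rewrite -[X in measurable X]setTI; exact: measurable_cdf01.
move=> x /=; rewrite /A /= in_itv/= => Fx; apply: eB => /= ex.
have : binomial_mean N (nth 0 v) (F x) < c.
  apply: epsP; rewrite /ball/= sub0r normrN ger0_norm ?cdf01_ge0//.
  by rewrite (le_lt_trans Fx)// ltr_pdivrMr// ltr_pMr// ltr1n.
rewrite -expected_prize_cdf ex ltNge lerDl => /negP; apply.
by rewrite mulr_ge0 ?(ltW marginal_cost_gt0)//; case/andP: (gamc_itv x).
Qed.

(** With c = 0, lam z is the mean prize, that is the mean of P_v(U): each of the N + 1 ranks is
    equally likely and the prizes sum to 1. *)
Lemma marginal_cost_mean : z * lam = N.+1%:R^-1.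
Proof.
have : c = 0 := surplus_eq0; rewrite /surplus => /eqP; rewrite subr_eq0 mulrC.
move=> /eqP <-.
pose b := binomial_mean N (nth 0 v).
have bb : bounded_measurable (b \o clamp01 (R := R)).
  exact/bounded_measurable_continuous/continuous_binomial_mean.
transitivity (\int[dcdf F]_x (b \o clamp01 (R := R)) (F x)).
  apply: eq_Rintegral => x _; rewrite expected_prize_cdf /=.
  by rewrite clamp01_id// cdf01_ge0 cdf01_le1.
rewrite (Rintegral_transform equilibrium_atomless bb).
(* Minus the partial sums: nonincreasing, with successive differences the prizes. *)
pose S k : R := - \sum_(j < k) v`_j.
have nS : {homo S : i j / (i <= j)%N >-> j <= i}.
  apply: homo_leq => [x|y x w xy yw|k]; [exact: lexx|exact: le_trans yw xy|].
  rewrite /S lerN2 big_ord_recr lerDl/=.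
  by case/andP: (prize_itv v_prize k).
have := integral_uniform_binomial_mean N nS.
rewrite (_ : (fun k => S k - S k.+1) = nth 0 v); last first.
  by apply/funext => k; rewrite /S big_ord_recr/=; ring.
have [_ _ v1] := v_prize.
rewrite /S big_ord0 v1 => E; rewrite /Rintegral /= E /=.
by rewrite oppr0 sub0r opprK mul1r.
Qed.

Lemma equilibrium_prize_ae :
  {ae dcdf F, forall x : mR, binomial_mean N (nth 0 v) (F x) = lam * gamc x}.
Proof.
apply: filterS expected_prize_ae => x.
by rewrite expected_prize_cdf surplus_eq0 add0r.
Qed.

End equilibrium.

Lemma mixture_itv (R : realType) (t a b B : R) : 0 <= t <= 1 ->
  a \in `[0, B] -> b \in `[0, B] -> t * a + (1 - t) * b \in `[0, B].
Proof.
rewrite !in_itv/= => /andP[t0 t1] /andP[a0 aB] /andP[b0 bB].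
have t1' : 0 <= 1 - t by rewrite subr_ge0.
rewrite addr_ge0 ?mulr_ge0//=.
by have := ler_wpM2l t0 aB; have := ler_wpM2l t1' bB; lra.
Qed.

(** * Utility as a function of the prize *)

Section rescaled_utility.
Variables (R : realType) (gam : R -> R) (lam : R) (u : R -> R).
Hypothesis gam_cont : {within `[0, 1], continuous gam}.
Hypothesis gam_incr : {in `[0, 1] &, {homo gam : x y / x < y}}.
Hypothesis gam_concave : convex_on `[0, 1]%classic (fun x => - gam x).
Hypothesis gam_0 : gam 0 = 0.
Hypothesis lam_gt0 : 0 < lam.
Hypothesis u_homo : {in `[0, 1] &, {homo u : x y / x <= y}}.
Hypothesis u_convex : convex_on `[0, 1]%classic u.

(* u composed with the inverse of lam * gam *)
Lemma rescaled_utility : exists f : R -> R,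
  [/\ convex_on `[0, lam * gam 1]%classic f,
      {in `[0, lam * gam 1] &, {homo f : x y / x <= y}} &
      forall x, 0 <= x <= 1 -> f (lam * gam x) = u x].
Proof.
have gam_le : {in `[0, 1] &, {mono gam : x y / x <= y}} by exact: le_mono_in.
have i0 : (0 : R) \in `[0, 1] by rewrite in_itv/= lexx ler01.
have i1 : (1 : R) \in `[0, 1] by rewrite in_itv/= lexx ler01.
have g1 : 0 <= gam 1 by rewrite -gam_0 gam_le.
(* The inverse of lam gam, by the intermediate value theorem; its value outside [0, lam gam(1)] is
   left arbitrary. *)
have /choice[g gP] : forall s : R, exists x, s \in `[0, lam * gam 1] ->
    x \in `[0, 1] /\ lam * gam x = s.
  move=> s; have [s01|s01] := boolP (s \in `[0, lam * gam 1]); last by exists 0.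
  move: (s01); rewrite in_itv/= => /andP[s0 s1].
  have [|x x01 gx] := IVT (v := s / lam) ler01 gam_cont.
    rewrite gam_0 (min_idPl g1) (max_idPr g1) divr_ge0 ?(ltW lam_gt0)//=.
    by rewrite ler_pdivrMr// mulrC.
  by exists x => _; rewrite gx mulrC divfK ?gt_eqF.
have gE x : x \in `[0, 1] -> g (lam * gam x) = x.
  move=> x01; have [|gx01] := gP (lam * gam x).
    rewrite in_itv/= mulr_ge0 ?(ltW lam_gt0)//= ?ler_wpM2l ?(ltW lam_gt0)//.
      by rewrite gam_le//; move: x01; rewrite in_itv/= => /andP[].
    by rewrite -gam_0 gam_le//; move: x01; rewrite in_itv/= => /andP[].
  by move=> /(mulfI (lt0r_neq0 lam_gt0)); exact: (inc_inj_in gam_le).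
exists (u \o g); split => [t a b /= a01 b01 t01|a b a01 b01 ab /=|x x01 /=].
- have [ga gaE] := gP _ a01; have [gb gbE] := gP _ b01.
  have ab01 := mixture_itv t01 a01 b01.
  have [gab gabE] := gP _ ab01.
  apply: le_trans (u_convex ga gb t01).
  (* As u is nondecreasing, it remains that the inverse [g] is convex; applying lam gam turns this
     into the concavity of gam. *)
  apply: u_homo => //; first exact: mixture_itv.
  rewrite -gam_le ?mixture_itv// -(ler_pM2l lam_gt0) gabE.
  rewrite (_ : t * a + _ = t * (lam * gam (g a)) + (1 - t) * (lam * gam (g b)));
    last by rewrite gaE gbE.
  have := gam_concave ga gb t01 => cc.
  have : t * gam (g a) + (1 - t) * gam (g b) <= gam (t * g a + (1 - t) * g b).
    by move: cc; lra.
  by move=> /(ler_wpM2l (ltW lam_gt0)); lra.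
- have [ga gaE] := gP _ a01; have [gb gbE] := gP _ b01.
  by apply: u_homo; rewrite // -gam_le// -(ler_pM2l lam_gt0) gaE gbE.
- by rewrite gE// in_itv.
Qed.

End rescaled_utility.

(** Almost surely u(X) = f(lam gam(X)) = f(P_v(F(X))), and F(X) is uniform. The bound 1 < lam gam(1)
    keeps prizes inside the domain of f. *)
Lemma Rintegral_quantile (R : realType) (F : cdf01 R) (N : nat) (v : nat -> R)
    (gam u f : R -> R) (lam : R) :
  (forall a, dcdf F [set a] = 0%E) ->
  {ae dcdf F, forall x : measurableTypeR R,
    binomial_mean N v (F x) = lam * gam (clamp01 x)} ->
  {homo v : i j / (i <= j)%N >-> j <= i} -> (forall k, 0 <= v k <= 1) ->
  1 < lam * gam 1 ->
  {in `[0, lam * gam 1] &, {homo f : x y / x <= y}} ->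
  (forall x, 0 <= x <= 1 -> f (lam * gam x) = u x) ->
  {in `[0, 1] &, {homo u : x y / x <= y}} ->
  \int[dcdf F]_(x in `[0, 1]) u x =
  \int[@uniform01 R]_x f (binomial_mean N v (clamp01 x)).
Proof.
move=> Fa Fae nv v01 lam1 nf fu nu.
have nfb : {in `[0, 1] &, {homo f \o binomial_mean N v : x y / x <= y}}.
  move=> x y x01 y01 xy /=.
  have b01 t : t \in `[0, 1] -> binomial_mean N v t \in `[0, lam * gam 1].
    rewrite !in_itv/= => t01; have /andP[-> /= b1] := binomial_mean_itv N t01 v01.
    exact: le_trans b1 (ltW lam1).
  by apply: nf; rewrite ?b01//; exact: binomial_mean_homo.
have bfb := bounded_measurable_homo nfb.
rewrite -(Rintegral_transform Fa bfb).
transitivity (\int[dcdf F]_x (u \o clamp01 (R := R)) x).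
  by rewrite /Rintegral integral_clamp01.
apply: eq_Rintegral_dcdf01; first exact: measurable_clamp01.
  by apply: measurableT_comp bfb.1 _; exact: measurable_cdf01.
apply: filterS Fae => x bx; rewrite /= (@clamp01_id R (F x)) ?cdf01_ge0 ?cdf01_le1// bx.
by rewrite fu// clamp01_itv.
Qed.

Theorem theorem4p3 (R : realType) (n : nat) (n_ge2 : (2 <= n)%N)
  (C : cdf01 R -> R) (gam Ups : R -> R)
  (C_def : forall F : cdf01 R,
    C F = Ups (\int[dcdf F]_(x in `[0, 1]) gam x))
  (gam_ge0 : forall x, x \in `[0, 1] -> 0 <= gam x)
  (gam_cont : {within `[0, 1], continuous gam})
  (gam_incr : {in `[0, 1] &, {homo gam : x y / x < y}})
  (gam_concave : convex_function (`[0, 1]%classic : set R) (fun x => - gam x))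
  (gam_0 : gam 0 = 0)
  (Ups_incr : {in `[0, gam 1] &, {homo Ups : x y / x <= y}})
  (Ups_convex : convex_function (`[0, gam 1]%classic : set R) Ups)
  (Ups_C1 : continuously_derivable_in `[0, gam 1] Ups)
  (zUps_incr : {in `[0, gam 1] &,
    {homo (fun z => z * derive_in `[0, gam 1] Ups z) : x y / x < y}})
  (Ups_0 : 1 < derive_in `[0, gam 1] Ups 0 * gam 1)
  (v w : n.-tuple R) (v_prize : prize_vector v) (w_prize : prize_vector w)
  (w_maj_v : majorizes w v)
  (v_top : v`_1 < v`_0) (w_top : w`_1 < w`_0)
  (F G : cdf01 R)
  (F_eq : symmetric_equilibrium v C F) (G_eq : symmetric_equilibrium w C G) :
  icx_dominates G F.
Proof.
case: n n_ge2 v w v_prize w_prize w_maj_v v_top w_top F_eq G_eq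
  => // N N0 {}v {}w pv pw [vw eqvw] v10 w10 Feq Geq.
have Uc := convex_functionW Ups_convex.
have Ud := Ups_C1.1.
have zF := marginal_cost_mean N0 C_def gam_ge0 gam_cont gam_incr gam_0 Uc Ud
  Ups_0 pv v10 Feq.
have zG := marginal_cost_mean N0 C_def gam_ge0 gam_cont gam_incr gam_0 Uc Ud
  Ups_0 pw w10 Geq.
have iF : mean_gam gam F \in `[0, gam 1] by rewrite in_itv/= mean_gam_itv.
have iG : mean_gam gam G \in `[0, gam 1] by rewrite in_itv/= mean_gam_itv.
(* Both values of z Ups'(z) equal 1 / n, and this map is injective. *)
have zFG : mean_gam gam F = mean_gam gam G.
  apply: (inc_inj_in (le_mono_in zUps_incr) iF iG).
  exact: etrans zF (esym zG).
have lamFG : marginal_cost gam Ups G = marginal_cost gam Ups F.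
  by rewrite /marginal_cost zFG.
have lam0 := marginal_cost_gt0 gam_ge0 gam_incr gam_0 Uc Ud Ups_0 F.
have lam1 := marginal_cost_gt1 gam_ge0 gam_incr gam_0 Uc Ud Ups_0 F.
move=> u nu cu.
(* As [lam] is common to both contests, the same f represents u for F and for G. *)
have [f [cf nf fu]] := rescaled_utility gam_cont gam_incr
  (convex_functionW gam_concave) gam_0 lam0 nu (convex_functionW cu).
have aF := equilibrium_atomless N0 C_def gam_ge0 gam_cont gam_incr gam_0 Uc Ud
  Ups_0 pv v10 Feq.
have aG := equilibrium_atomless N0 C_def gam_ge0 gam_cont gam_incr gam_0 Uc Ud
  Ups_0 pw w10 Geq.
have eF := equilibrium_prize_ae N0 C_def gam_ge0 gam_cont gam_incr gam_0 Uc Ud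
  Ups_0 pv v10 Feq.
have := equilibrium_prize_ae N0 C_def gam_ge0 gam_cont gam_incr gam_0 Uc Ud
  Ups_0 pw w10 Geq.
rewrite lamFG => eG.
rewrite (Rintegral_quantile aF eF (prize_homo pv) (prize_itv pv) lam1 nf fu nu).
rewrite (Rintegral_quantile aG eG (prize_homo pw) (prize_itv pw) lam1 nf fu nu).
(* Majorization speaks of m >= 1; the empty partial sum is treated apart. *)
apply: (convex_order_binomial_mean (prize_homo pv) (prize_homo pw)
  (prize_itv pv) (prize_itv pw) _ eqvw lam1 cf nf) => -[_|m mN].
  by rewrite !big_ord0.
exact: vw.
Qed.
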